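(* Let $\rho$ and $\mu$ be Borel probability measures on $\mathbb{R}^d$, and let $c:\mathbb{R}^d\times\mathbb{R}^d\to\mathbb{R}$ be continuous and such that $|c(x,y)|\le a(x)+b(y)$ for all $(x,y)\in\mathbb{R}^d\times\mathbb{R}^d$, for some real-valued upper semi-continuous functions $a\in L^1(\rho)$, $b\in L^1(\mu)$. Then $$\Phi_c(\rho,\mu)=\left\{\phi\in L^1(\rho):\ \phi(x)-\phi(x')\le\lambda_{\rho,\mu,c}(x,x')\quad\forall x,x'\in P_x(\Gamma)\right\}.$$ Here the equality is understood modulo modification of functions on $\rho$-null sets: a $\rho$-a.e. equivalence class belongs to the right-hand side if it has a representative, real-valued on $P_x(\Gamma)$, satisfying the stated inequalities.
   Context: $\Pi(\rho,\mu)$ is the set of couplings of $\rho$ and $\mu$; $\operatorname{spt}$ is the support. $\Gamma_c(\rho,\mu):=\operatorname{argmin}_{\gamma\in\Pi(\rho,\mu)}\int c\,\mathrm{d}\gamma$ is the set of optimal plans, $\operatorname{spt}\Gamma:=\bigcup_{\gamma\in\Gamma_c(\rho,\mu)}\operatorname{spt}\gamma$, and $P_x(\Gamma):=\operatorname{proj}_x(\operatorname{spt}\Gamma)\subseteq\operatorname{spt}\rho$ is its projection onto the first factor (it has full $\rho$-measure). For $x,x'\in P_x(\Gamma)$, $$\lambda_{\rho,\mu,c}(x,x'):=\inf_{\substack{\{(x_i,y_i)\}_{i=0}^n\subseteq\operatorname{spt}\Gamma\\ x_0=x',\ x_n=x}}\ \sum_{i=0}^{n-1}\big[c(x_{i+1},y_i)-c(x_i,y_i)\big],$$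 the infimum being over all finite chains (all lengths $n$). Dual optimal transport problem: maximise $\int\phi\,\mathrm{d}\rho+\int\psi\,\mathrm{d}\mu$ over $(\phi,\psi)\in L^1(\rho)\times L^1(\mu)$ (functions with values in $\mathbb{R}\cup\{-\infty\}$) subject to $\phi(x)+\psi(y)\le c(x,y)$ for all $(x,y)$. $\Phi_c(\rho,\mu):=\{\phi\in L^1(\rho):\exists\,\psi\in L^1(\mu)\text{ with }(\phi,\psi)\text{ optimal for the dual problem}\}$. *)

(* Defs.v *)
From HB Require Import structures.
From mathcomp Require Import all_boot all_order all_algebra.
From mathcomp Require Import all_classical all_reals all_analysis.

Set Implicit Arguments.
Unset Strict Implicit.
Unset Printing Implicit Defensive.

Import Order.TTheory GRing.Theory Num.Theory.
Import numFieldNormedType.Exports.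

Local Open Scope classical_set_scope.
Local Open Scope ring_scope.

(* The library declares the pointed and the topological structure of a product
   separately, without their join. *)
HB.instance Definition _ (X Y : ptopologicalType) := Pointed.on (X * Y)%type.

Notation borel T := (g_sigma_algebraType (@open T)).

Definition upper_semicontinuous (T : topologicalType) (R : realType)
    (f : T -> R) : Prop :=
  forall x t, f x < t -> \forall y \near x, f y < t.

Definition spt (R : realType) (T : ptopologicalType)
    (m : probability (borel T) R) : set T :=
  [set x | forall U : set T, open U -> U x -> (0 < m U)%E].

(* Integrable (Borel) functions with values in [-oo, +oo[; these are functions,
   not classes modulo null sets. *)
Definition L1 (disp : measure_display) (T : measurableType disp)
    (R : realType) (m : probability T R) : set (T -> \bar R) :=
  [set f | m.-integrable setT f /\ forall x, f x != +oo%E].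

(* The functions in L1 m that agree m-almost everywhere with an element of A:
   two subsets of L1 m determine the same classes iff their modulo_null are
   equal. *)
Definition modulo_null (disp : measure_display) (T : measurableType disp)
    (R : realType) (m : probability T R) (A : set (T -> \bar R)) :
    set (T -> \bar R) :=
  [set f | L1 m f /\ exists2 g, A g & ae_eq m setT f g].

Section OptimalTransport.
Context (R : realType) (X Y : ptopologicalType).
Variables (rho : probability (borel X) R) (mu : probability (borel Y) R).
Variable c : X * Y -> R.

(* The marginals are compared on Borel sets only: a measure takes junk values
   on non-measurable sets. *)
Definition coupling : set (probability (borel (X * Y)%type) R) :=
  [set g | (forall A : set X, measurable (A : set (borel X)) ->
              g (fst @^-1` A) = rho A) /\
           (forall B : set Y, measurable (B : set (borel Y)) ->
              g (snd @^-1` B) = mu B)].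

Definition cost (g : probability (borel (X * Y)%type) R) : \bar R :=
  (\int[g]_z (c z)%:E)%E.

Definition optimal_plan : set (probability (borel (X * Y)%type) R) :=
  [set g | coupling g /\ forall g', coupling g' -> (cost g <= cost g')%E].

Definition spt_opt : set (X * Y) := \bigcup_(g in optimal_plan) spt (T := (X * Y)%type) g.

Definition proj_opt : set X := fst @` spt_opt.

Definition chain (x x' : X) (n : nat) (z : nat -> X * Y) : Prop :=
  [/\ forall i, (i <= n)%N -> spt_opt (z i), (z 0%N).1 = x' & (z n).1 = x].

Definition chain_sum (n : nat) (z : nat -> X * Y) : R :=
  \sum_(0 <= i < n) (c ((z i.+1).1, (z i).2) - c ((z i).1, (z i).2)).

(* The point (z n).2 does not enter the sum; n = 0 is possible only if x = x'
   and then contributes 0, as does the constant chain of length 1. *)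
Definition lambda (x x' : X) : \bar R :=
  ereal_inf [set e | exists n z, chain x x' n z /\ e = (chain_sum n z)%:E].

Definition dual_feasible (f : X -> \bar R) (h : Y -> \bar R) : Prop :=
  [/\ L1 rho f, L1 mu h & forall x y, (f x + h y <= (c (x, y))%:E)%E].

Definition dual_value (f : X -> \bar R) (h : Y -> \bar R) : \bar R :=
  (\int[rho]_x f x + \int[mu]_y h y)%E.

Definition dual_optimal (f : X -> \bar R) (h : Y -> \bar R) : Prop :=
  dual_feasible f h /\
  forall f' h', dual_feasible f' h' -> (dual_value f' h' <= dual_value f h)%E.

Definition Phi : set (X -> \bar R) :=
  [set f | L1 rho f /\ exists2 h, L1 mu h & dual_optimal f h].

End OptimalTransport.

(* Main.v *)
Require Import Defs.
From HB Require Import structures.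
From mathcomp Require Import all_boot all_order all_algebra.
From mathcomp Require Import all_classical all_reals all_analysis.
From mathcomp Require Import measurable_realfun.
From mathcomp Require Import ring lra.

(** An optimal plan exists although [c] is only bounded by [a + b]: an ultrafilter
    limit of couplings is finitely additive, and since its marginals are fixed Radon
    measures it is countably additive on rectangles, hence extends to a coupling;
    truncating [c] from below costs at most the tails of [a] and [b], uniformly in the
    coupling. Exchanging mass along a cycle shows that the support of an optimal plan is
    cyclically monotone, and Rockafellar's potential then gives duality without gap.

    If [(f, h)] is optimal, so are its c-conjugates, which are upper semicontinuous; by
    duality their contact set with [c] is a closed set of full mass for every optimal
    plan, so it contains [spt_opt], and summing along chains bounds [f x - f x'] by
    [lambda x x']. Conversely a function bounded by [lambda] is, on the projection of the
    support of an optimal plan, a c-concave potential of that support. *)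

Set Implicit Arguments.
Unset Strict Implicit.
Unset Printing Implicit Defensive.
Import Order.TTheory GRing.Theory Num.Theory.
Import numFieldNormedType.Exports.
Local Open Scope classical_set_scope.
Local Open Scope ring_scope.

(** * Borel sets of a product *)

(** The argument is set in two spaces with countable bases of open sets and regular measures on
    them; row vectors enter at the end. The base makes rectangles generate the Borel sets of the
    product, and makes the complement of a support null. Regularity supplies the compact rectangles
    behind countable additivity.

    Existence of an optimal plan is indispensable: were there none, [proj_opt] would be empty and
    the right-hand side would be all of [L1 rho].

    The union over all optimal plans in [spt_opt] weighs differently on the two inclusions. For the
    bound by [lambda], a single dual pair must touch [c] on the support of every optimal plan, so
    duality without gap is used for each of them. For the converse, one plan and chains of length
    one suffice.

    Each inclusion has to change the function on a null set. An optimal [f] may be lowered at a null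
    point of [proj_opt] and stay optimal while the inequalities fail there; its conjugate is the
    good representative. Conversely, off the projection of the support a function bounded by
    [lambda] may be too large to be feasible, and the c-concave extension replaces it. *)

Definition open_base (T : topologicalType) (B : nat -> set T) :=
  (forall i, open (B i)) /\
  forall O x, open O -> O x -> exists i, B i x /\ B i `<=` O.

Definition rectangles (X Y : ptopologicalType) : set (set (X * Y)) :=
  [set R | exists A : set X, exists B : set Y,
     [/\ measurable (A : set (borel X)), measurable (B : set (borel Y)) &
         R = A `*` B]].

Lemma open_borel (T : ptopologicalType) (A : set T) :
  open A -> measurable (A : set (borel T)).
Proof. exact: sub_sigma_algebra. Qed.

Lemma closed_borel (T : ptopologicalType) (A : set T) :
  closed A -> measurable (A : set (borel T)).
Proof.
move=> cA; rewrite -[A]setCK; apply: measurableC; apply: open_borel.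
exact: closed_openC.
Qed.

Lemma continuous_borel (S T : ptopologicalType) (f : S -> T) :
  continuous f -> measurable_fun setT (f : borel S -> borel T).
Proof.
move=> cf; apply: (@measurability _ _ (borel S) (borel T) setT f (@open T)) => //.
move=> _ [B oB <-]; rewrite setTI; apply: open_borel.
by apply: open_comp => // x _; exact: cf.
Qed.

Lemma measurable_fst_borel (X Y : ptopologicalType) :
  measurable_fun setT (fst : borel (X * Y)%type -> borel X).
Proof. by apply: continuous_borel => -[x y]; exact: cvg_fst. Qed.

Lemma measurable_snd_borel (X Y : ptopologicalType) :
  measurable_fun setT (snd : borel (X * Y)%type -> borel Y).
Proof. by apply: continuous_borel => -[x y]; exact: cvg_snd. Qed.

Lemma open_setX (X Y : topologicalType) (A : set X) (B : set Y) :
  open A -> open B -> open (A `*` B).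
Proof.
move=> oA oB; rewrite openE => -[x y] [/= Ax By].
by exists (A, B) => //=; split; apply: open_nbhs_nbhs.
Qed.

Lemma measurable_setX_borel (X Y : ptopologicalType) (A : set X) (B : set Y) :
  measurable (A : set (borel X)) -> measurable (B : set (borel Y)) ->
  measurable (A `*` B : set (borel (X * Y)%type)).
Proof.
move=> mA mB.
have -> : A `*` B = (fst @^-1` A) `&` (snd @^-1` B) by [].
apply: measurableI; rewrite -[X in measurable X]setTI.
- exact: measurable_fst_borel.
- exact: measurable_snd_borel.
Qed.

Lemma open_base_prod (X Y : ptopologicalType) (B1 : nat -> set X)
    (B2 : nat -> set Y) :
  open_base B1 -> open_base B2 ->
  exists B : nat -> set X * set Y,
    [/\ forall i, open (B i).1, forall i, open (B i).2 &
        open_base (fun i => (B i).1 `*` (B i).2)].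
Proof.
move=> [ob1 b1] [ob2 b2].
(* A number that encodes no pair falls back on the indices [(0, 0)]; this is harmless, since a
   listed set only has to be an open rectangle. *)
pose B i := let k := odflt (0%N, 0%N) (unpickle i) in (B1 k.1, B2 k.2).
exists B; split; [by move=> i; exact: ob1|by move=> i; exact: ob2|split].
  by move=> i; apply: open_setX; [exact: ob1|exact: ob2].
move=> U [x y] oU Uxy.
have : nbhs (x, y) U by apply: open_nbhs_nbhs.
case=> -[P Q] /= [nP nQ] PQ.
have [i [Bix iP]] := b1 _ x (@open_interior _ P) nP.
have [j [Bjy jQ]] := b2 _ y (@open_interior _ Q) nQ.
exists (pickle (i, j)); rewrite /B pickleK /=; split => // -[u v] [/= iu jv].
apply: PQ; split => /=.
  exact: (interior_subset (iP _ iu)).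
exact: (interior_subset (jQ _ jv)).
Qed.

Lemma open_base_bigcup (T : topologicalType) (B : nat -> set T) (O : set T) :
  open_base B -> open O -> O = \bigcup_(i in [set i | B i `<=` O]) B i.
Proof.
move=> [ob bB] oO; apply/seteqP; split=> [x Ox|x [i /= iO /iO //]].
by have [i [Bix iO]] := bB _ _ oO Ox; exists i.
Qed.

(** Countability of the bases is what makes an open set of the product a countable union of open
    rectangles, hence a member of the sigma-algebra that rectangles generate. *)
Lemma borel_prodE (X Y : ptopologicalType) (B1 : nat -> set X)
    (B2 : nat -> set Y) :
  open_base B1 -> open_base B2 ->
  @measurable _ (borel (X * Y)%type) = <<s @rectangles X Y >>.
Proof.
move=> b1 b2; apply/seteqP; split.
- apply: smallest_sub; first exact: smallest_sigma_algebra.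
  move=> O oO; have [B [ob1 ob2 bB]] := open_base_prod b1 b2.
  rewrite (open_base_bigcup bB oO).
  pose sT := g_sigma_algebraType (@rectangles X Y).
  apply: (@bigcup_measurable _ sT) => i _; apply: sub_sigma_algebra.
  exists (B i).1, (B i).2; split => //; exact: open_borel.
- apply: smallest_sub; first exact: sigma_algebra_measurable.
  by move=> _ [A [B [mA mB ->]]]; exact: measurable_setX_borel.
Qed.

(** A point outside the support lies in a base set of measure zero, and there are only countably
    many of these. *)
Lemma spt_null (R : realType) (T : ptopologicalType) (B : nat -> set T)
    (m : probability (borel T) R) :
  open_base B -> m.-negligible (~` spt m).
Proof.
move=> [ob bB].
pose N i := if m (B i) == 0%E then B i else set0.
apply: (@negligibleS _ _ _ m (\bigcup_i N i)).
  move=> x /= /existsNP[U] /not_implyP[oU /not_implyP[Ux mU]].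
  have [i [Bix iU]] := bB U x oU Ux; exists i => //; rewrite /N.
  case: eqP => // mBi; exfalso; apply: mU; apply: (@lt_le_trans _ _ (m (B i))).
    by rewrite lt0e measure_ge0 andbT; exact/eqP.
  by apply: le_measure => //; rewrite inE; exact: open_borel.
apply: negligible_bigcup => i; rewrite /N.
case: eqP => [mBi|_]; last exact: negligible_set0.
by apply/negligibleP => //; exact: open_borel.
Qed.

Lemma measurable_usc (T : ptopologicalType) (R : realType)
    (f : T -> \bar R) :
  (forall t : R, open [set x | (f x < t%:E)%E]) ->
  measurable_fun [set: borel T] f.
Proof.
move=> of_; apply: (@measurability _ _ (borel T) _ setT f _ (ErealGenInftyO.measurableE R)) => _ /= -[_ [t ->] <-].
rewrite setTI; apply: open_borel.
suff -> : f @^-1` `]-oo, t%:E[ = [set x | (f x < t%:E)%E] by exact: of_.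
by apply/seteqP; split=> x; rewrite /= in_itv.
Qed.

(** * Extending a finitely additive set function from rectangles *)

Section MeasureOfFunction.
Context (d : measure_display) (T : measurableType d) (R : realType).
Variable P : set T -> \bar R.
Hypotheses (P0 : P set0 = 0%E) (Pge0 : forall A, (0 <= P A)%E)
  (Psig : semi_sigma_additive P).

(** A name for [P] to which the measure structure can be attached; [exists_measure] then hides the
    structure behind an existential, so that later constructions only handle the values. *)
Definition as_measure : set T -> \bar R := P.

HB.instance Definition _ := isMeasure.Build d T R as_measure P0 Pge0 Psig.

Lemma exists_measure : exists m : {measure set T -> \bar R}, forall A, m A = P A.
Proof. by exists as_measure. Qed.

End MeasureOfFunction.

Section ProbabilityOfMeasure.
Context (d : measure_display) (T : measurableType d) (R : realType).
Variable P : {measure set T -> \bar R}.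
Hypotheses (P1 : P setT = 1%E).

Definition as_probability : set T -> \bar R := P.

HB.instance Definition _ := Measure.on as_probability.
HB.instance Definition _ := Measure_isProbability.Build d T R as_probability P1.

Lemma exists_probability : exists p : probability T R, forall A, p A = P A.
Proof. by exists as_probability. Qed.

End ProbabilityOfMeasure.

Lemma exists_pushforward (d d' : measure_display) (S : measurableType d)
    (T : measurableType d') (R : realType) (m : {measure set S -> \bar R})
    (f : S -> T) :
  measurable_fun setT f ->
  exists p : {measure set T -> \bar R}, forall A, p A = m (f @^-1` A).
Proof.
move=> mf; apply: (@exists_measure _ _ _ (fun A => m (f @^-1` A))) => //.
- by rewrite preimage_set0 measure0.
- move=> F mF tF mUF; rewrite preimage_bigcup.
  apply: measure_semi_sigma_additive.
  + by move=> n; rewrite -[X in measurable X]setTI; exact: mf.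
  + apply/trivIsetP => /= i j _ _ ij; rewrite -preimage_setI.
    by move/trivIsetP : tF => /(_ _ _ _ _ ij) ->//; rewrite preimage_set0.
  + by rewrite -preimage_bigcup -[X in measurable X]setTI; exact: mf.
Qed.

(** An alias of [X * Y] whose measurable sets are the rectangles. These form a semiring only, which
    is where the extension of a content to a measure starts. *)
Definition rect_type (X Y : ptopologicalType) : Type := (X * Y)%type.

Definition rect_display : measure_display. Proof. by []. Qed.

Section RectangleSemiring.
Context (X Y : ptopologicalType).

HB.instance Definition _ := Pointed.on (rect_type X Y).

Let rect0 : @rectangles X Y set0.
Proof. by exists set0, set0; split; rewrite ?set0X. Qed.

Lemma rectanglesI : setI_closed (@rectangles X Y).
Proof.
move=> _ _ [A [B [mA mB ->]]] [C [D [mC mD ->]]].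
exists (A `&` C), (B `&` D); split; try exact: measurableI.
by apply/seteqP; split => -[x y] /=; tauto.
Qed.

Let rectD : semi_setD_closed (@rectangles X Y).
Proof.
move=> _ _ [A [B [mA mB ->]]] [C [D [mC mD ->]]].
exists [set (A `\` C) `*` B; (A `&` C) `*` (B `\` D)]; split.
- exact: finite_set2.
- move=> _ [->|->].
  + by exists (A `\` C), B; split => //; exact: measurableD.
  + exists (A `&` C), (B `\` D); split => //; first exact: measurableI.
    exact: measurableD.
- rewrite bigcup_setU1 bigcup_set1.
  apply/seteqP; split => -[x y] /=; last by tauto.
  by move=> [[Ax By] nCD]; case: (pselect (C x)) => Cx; [right|left]; tauto.
- by move=> _ _ [->|->] [->|->] //= [[x y] /=] [? ?]; exfalso; tauto.
Qed.

HB.instance Definition _ := isSemiRingOfSets.Build rect_display (rect_type X Y)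
  rect0 rectanglesI rectD.

End RectangleSemiring.

(* Additive on all Borel sets but only finitely so: the limit of couplings along
   an ultrafilter is of this kind. *)
Definition finitely_additive (R : realType) (T : ptopologicalType)
    (lam : set T -> R) :=
  forall E F : set T, measurable (E : set (borel T)) ->
    measurable (F : set (borel T)) -> E `&` F = set0 ->
    lam (E `|` F) = lam E + lam F.

(** Inner approximation by compact sets and outer approximation by open sets in a single inequality.
    Measurability of [K] is part of the definition because in a general space a compact set need not
    be closed. *)
Definition regular (R : realType) (T : ptopologicalType)
    (m : probability (borel T) R) :=
  forall A : set T, measurable (A : set (borel T)) -> forall e : R, 0 < e ->
  exists K U : set T, [/\ compact K, measurable (K : set (borel T)), open U,
     K `<=` A & A `<=` U] /\ (m (U `\` K) <= e%:E)%E.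

Section FinitelyAdditive.
Context (R : realType) (T : ptopologicalType) (lam : set T -> R).
Hypotheses (lam_ge0 : forall E, 0 <= lam E) (lamD : finitely_additive lam).
Let bT := borel T.

Lemma fadd0 : lam set0 = 0.
Proof.
have := @lamD set0 set0 measurable0 measurable0 (setI0 _).
rewrite setU0 => /eqP; rewrite -subr_eq0 opprD addrA subrr add0r oppr_eq0.
by move/eqP.
Qed.

Lemma le_fadd (E F : set T) : measurable (E : set bT) -> measurable (F : set bT) ->
  E `<=` F -> lam E <= lam F.
Proof.
move=> mE mF EF; rewrite -(setDUK EF) lamD ?lerDl//; first exact: measurableD.
by rewrite setDE setICA setICr setI0.
Qed.

Lemma faddU (E F : set T) : measurable (E : set bT) -> measurable (F : set bT) ->
  lam (E `|` F) <= lam E + lam F.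
Proof.
move=> mE mF; have -> : E `|` F = E `|` (F `\` E) 
  by apply/seteqP; split=> x /=; case: (pselect (E x)) => Ex; tauto.
have mFE : measurable (F `\` E : set bT) by exact: measurableD.
rewrite lamD// ?lerD2l; last by rewrite setDE setICA setICr setI0.
by apply: le_fadd => //; exact: subDsetl.
Qed.

Lemma fadd_bigU (F : nat -> set T) n : (forall i, measurable (F i : set bT)) ->
  lam (\big[setU/set0]_(i < n) F i) <= \sum_(i < n) lam (F i).
Proof.
move=> mF; elim: n => [|n IH]; first by rewrite !big_ord0 fadd0.
rewrite !big_ord_recr /=; apply: le_trans (faddU _ _) _ => //.
  by apply: (@bigsetU_measurable _ bT) => i _.
by rewrite lerD2r.
Qed.

Lemma fadd_trivIset (F : nat -> set T) n : (forall i, measurable (F i : set bT)) ->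
  trivIset setT F ->
  lam (\big[setU/set0]_(i < n) F i) = \sum_(i < n) lam (F i).
Proof.
move=> mF tF; elim: n => [|n IH]; first by rewrite !big_ord0 fadd0.
rewrite !big_ord_recr /= lamD ?IH//.
  by apply: (@bigsetU_measurable _ bT) => i _.
rewrite -bigcup_mkord setI_bigcupl; apply: bigcup0 => i /= i_n.
by move/trivIsetP : tF; apply => //; rewrite ltn_eqF.
Qed.

End FinitelyAdditive.

Section RectangleContent.
Context (R : realType) (X Y : ptopologicalType).
Variables (rho : probability (borel X) R) (mu : probability (borel Y) R).
Variable lam : set (X * Y) -> R.
Hypotheses (rho_reg : regular rho) (mu_reg : regular mu).
Hypotheses (lam_ge0 : forall E, 0 <= lam E) (lamD : finitely_additive lam).
Hypothesis lam_fst : forall A : set X, measurable (A : set (borel X)) ->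
  (lam (A `*` setT))%:E = rho A.
Hypothesis lam_snd : forall B : set Y, measurable (B : set (borel Y)) ->
  (lam (setT `*` B))%:E = mu B.

Definition rect_content : set (rect_type X Y) -> \bar R := EFin \o lam.

Let rect_borel (E : set (rect_type X Y)) :
  measurable E -> measurable (E : set (borel (X * Y)%type)).
Proof. by move=> [A [B [mA mB ->]]]; exact: measurable_setX_borel. Qed.

Let rect_content_ge0 E : (0 <= rect_content E)%E.
Proof. by rewrite lee_fin. Qed.

Let rect_content_additive : measure_function.semi_additive rect_content.
Proof.
move=> F n mF tF _; rewrite /rect_content /= sumEFin; congr EFin.
by apply: (fadd_trivIset lamD) => // i; exact: rect_borel.
Qed.

HB.instance Definition _ := isContent.Build rect_display (rect_type X Y) R
  rect_content rect_content_ge0 rect_content_additive.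

(** What [U * V] has beyond [A * B] lies over [U \ A] or over [V \ B], and the masses of these
    strips are given by the marginals. Thus [lam], which is not known to be regular, inherits
    regularity on rectangles. *)
Lemma fadd_enlarge (A U : set X) (B V : set Y) (a b : R) :
  measurable (A : set (borel X)) -> measurable (U : set (borel X)) ->
  measurable (B : set (borel Y)) -> measurable (V : set (borel Y)) ->
  (rho (U `\` A) <= a%:E)%E -> (mu (V `\` B) <= b%:E)%E ->
  lam (U `*` V) <= lam (A `*` B) + (a + b).
Proof.
move=> mA mU mB mV; rewrite -lam_fst; last exact: measurableD.
rewrite -lam_snd; last exact: measurableD.
rewrite !lee_fin => ha hb.
have mAB : measurable (A `*` B : set (borel (X * Y)%type)) by exact: measurable_setX_borel.
have m1 : measurable ((U `\` A) `*` setT : set (borel (X * Y)%type)).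
  by apply: measurable_setX_borel => //; exact: measurableD.
have m2 : measurable (setT `*` (V `\` B) : set (borel (X * Y)%type)).
  by apply: measurable_setX_borel => //; exact: measurableD.
have m12 := measurableU _ _ m1 m2.
have mUV : measurable (U `*` V : set (borel (X * Y)%type)) by exact: measurable_setX_borel.
have /(le_fadd lam_ge0 lamD mUV (measurableU _ _ mAB m12)) : U `*` V `<=`
    A `*` B `|` ((U `\` A) `*` setT `|` setT `*` (V `\` B)).
  move=> [x y] [/= Ux Vy]; case: (pselect (A x)) => Ax; last by right; left.
  by case: (pselect (B y)) => By; [left|right; right].
move=> /le_trans; apply; apply: le_trans (faddU lam_ge0 lamD mAB m12) _.
rewrite lerD2l; apply: le_trans (faddU lam_ge0 lamD m1 m2) _.
exact: lerD.
Qed.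

(** Compactness reduces the countable cover to a finite one: the rectangle is shrunk to a compact
    one, the covering rectangles are enlarged to open ones at a summable cost, and finitely many of
    the latter cover the former. Only finite subadditivity of [lam] is then used. *)
Let rect_content_sub : measurable_subset_sigma_subadditive rect_content.
Proof.
move=> E F mF [A [B [mA mB ->]]] EF.
apply/lee_addgt0Pr => _/posnumP[e].
have e8 : 0 < e%:num / 4 by rewrite divr_gt0.
have [K [U [[cK mK oU KA AU] hK]]] := rho_reg mA e8.
have [L [V [[cL mL oV LB BV] hL]]] := mu_reg mB e8.
(* The last halving accounts for the two sides of a rectangle: enlarging [F i] costs [de i + de i],
   and these costs add up to at most [e / 2]. The other half of [e] is spent on shrinking
   [A * B]. *)
pose de i : R := e%:num / 2 / (2 ^ i.+1)%:R / 2.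
have de0 i : 0 < de i by rewrite !divr_gt0// ltr0n// expn_gt0.
have /choice[G hG] : forall i, exists UV : set X * set Y,
    [/\ open UV.1, open UV.2, F i `<=` UV.1 `*` UV.2 &
        lam (UV.1 `*` UV.2) <= lam (F i) + (de i + de i)].
  move=> i; have [A' [B' [mA' mB' ->]]] := mF i.
  have [K' [U' [[_ mK' oU' KA' AU'] hK']]] := rho_reg mA' (de0 i).
  have [L' [V' [[_ mL' oV' LB' BV'] hL']]] := mu_reg mB' (de0 i).
  exists (U', V'); split => //=; first by move=> [x y] [/= /AU' ? /BV' ?].
  apply: fadd_enlarge => //; try exact: open_borel.
    apply: le_trans hK'; apply: le_measure; rewrite ?inE.
    - by apply: measurableD => //; exact: open_borel.
    - by apply: measurableD => //; exact: open_borel.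
    - exact: setDS.
  apply: le_trans hL'; apply: le_measure; rewrite ?inE.
  - by apply: measurableD => //; exact: open_borel.
  - by apply: measurableD => //; exact: open_borel.
  - exact: setDS.
have mG i : measurable ((G i).1 `*` (G i).2 : set (borel (X * Y)%type)).
  by have [w1 w2 _ _] := hG i; apply: measurable_setX_borel; exact: open_borel.
have cKL : compact (K `*` L) by exact: compact_setX.
move: (cKL); rewrite compact_cover => /(_ nat setT (fun i => (G i).1 `*` (G i).2)).
case=> [i _|z [/= Kz Lz]|D _ KLD].
- by have [w1 w2 _ _] := hG i; exact: open_setX.
- have [i _ Fiz] : (\bigcup_i F i) z by apply: EF; split; [exact: KA|exact: LB].
  by exists i => //; have [_ _ + _] := hG i; exact.
pose n := (\max_(i <- finmap.enum_fset D) i).+1.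
have KLn : K `*` L `<=` \big[setU/set0]_(i < n) ((G i).1 `*` (G i).2).
  move=> z /KLD[i /= iD Giz]; rewrite -(bigcup_mkord n (fun i => (G i).1 `*` (G i).2)).
  by exists i => //=; rewrite /n ltnS; apply: (@leq_bigmax_seq _ _ _ id).
have mKL : measurable (K `*` L : set (borel (X * Y)%type)) by exact: measurable_setX_borel.
have s1 : lam (A `*` B) <= lam (K `*` L) + (e%:num / 4 + e%:num / 4).
  apply: fadd_enlarge => //.
    apply: le_trans hK; apply: le_measure; rewrite ?inE.
    - exact: measurableD.
    - by apply: measurableD => //; exact: open_borel.
    - exact: setSD.
  apply: le_trans hL; apply: le_measure; rewrite ?inE.
  - exact: measurableD.
  - by apply: measurableD => //; exact: open_borel.
  - exact: setSD.
have s2 : lam (K `*` L) <= \sum_(i < n) (lam (F i) + e%:num / 2 / (2 ^ i.+1)%:R).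
  apply: le_trans (le_fadd lam_ge0 lamD mKL _ KLn) _.
    by apply: (@bigsetU_measurable _ (borel (X * Y)%type)) => i _; exact: mG.
  apply: le_trans (fadd_bigU lam_ge0 lamD n mG) _.
  apply: ler_sum => i _; have [_ _ _ /le_trans] := hG i; apply.
  by rewrite lerD2l /de -splitr.
rewrite [e%:num]splitr [in leRHS]EFinD addeA.
apply: le_trans (_ : ((\sum_(i < n) (lam (F i) + e%:num / 2 / (2 ^ i.+1)%:R)) +
   e%:num / 2)%:E <= _)%E.
  rewrite /rect_content /= lee_fin; apply: le_trans s1 _; apply: lerD s2 _.
  have -> : e%:num / 2 = e%:num / 4 + e%:num / 4 by field.
  exact: lexx.
rewrite EFinD; apply: leeD => //.
apply: le_trans (epsilon_trick _ _ _); last 2 first.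
- by move=> i; exact: rect_content_ge0.
- by rewrite divr_ge0.
rewrite -sumEFin -(big_mkord xpredT (fun i => (lam (F i) + e%:num / 2 / (2 ^ i.+1)%:R)%:E)).
apply: nneseries_lim_ge => i _ _.
by rewrite lee_fin addr_ge0// !divr_ge0.
Qed.

HB.instance Definition _ := Content_SigmaSubAdditive_isMeasure.Build _ _ _
  rect_content rect_content_sub.

Theorem rect_content_extension (B1 : nat -> set X) (B2 : nat -> set Y) :
  open_base B1 -> open_base B2 ->
  exists g : probability (borel (X * Y)%type) R, coupling rho mu g /\
    forall A B, measurable (A : set (borel X)) -> measurable (B : set (borel Y)) ->
      g (A `*` B) = (lam (A `*` B))%:E.
Proof.
move=> b1 b2.
pose sT := g_sigma_algebraType (@measurable _ (rect_type X Y)).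
(* The sigma-algebra of the extension and the Borel one have the same sets but are different types;
   pushing forward along the identity passes from one to the other. *)
have mid : measurable_fun setT (id : sT -> borel (X * Y)%type).
  by move=> _ E mE; rewrite setTI preimage_id -[measurable _]/(<<s @rectangles X Y >> E) -(borel_prodE b1 b2).
have [m hm] := exists_pushforward (measure_extension rect_content) mid.
have mrect A B : measurable (A : set (borel X)) -> measurable (B : set (borel Y)) ->
    m (A `*` B) = (lam (A `*` B))%:E.
  move=> mA mB; rewrite hm preimage_id.
  by apply: (@measurable_mu_extE _ _ _ rect_content); exists A, B.
have m1 : m setT = 1%E.
  by rewrite -setXTT mrect// lam_fst// probability_setT.
have [g hg] := exists_probability m1.
exists g; split; last by move=> A B mA mB; rewrite hg mrect.
split=> [A mA|B mB]; rewrite hg.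
- by rewrite -lam_fst// -mrect//; congr (m _); apply/seteqP; split => -[x y] /=; tauto.
- by rewrite -lam_snd// -mrect//; congr (m _); apply/seteqP; split => -[x y] /=; tauto.
Qed.

End RectangleContent.

(** * Integration against couplings *)

Section ImageMeasure.
Context (d d' : measure_display) (S : measurableType d) (T : measurableType d')
  (R : realType) (m : {measure set S -> \bar R}) (p : {measure set T -> \bar R}).
Variable phi : S -> T.
Hypotheses (mphi : measurable_fun setT phi)
  (imE : forall A, measurable A -> m (phi @^-1` A) = p A).
Local Open Scope ereal_scope.

(** The measure [p] agrees with the image of [m] on measurable sets only, so it is not literally the
    pushforward; integrals do not see the difference. *)
Lemma image_ge0_integral (f : T -> \bar R) :
  measurable_fun setT f -> (forall y, 0 <= f y) ->
  \int[m]_x f (phi x) = \int[p]_y f y.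
Proof.
move=> mf f0; transitivity (\int[pushforward m phi]_y f y).
  by rewrite ge0_integral_pushforward.
by apply: eq_measure_integral => A mA _; exact: imE.
Qed.

Lemma image_integrable (f : T -> \bar R) : measurable_fun setT f ->
  m.-integrable setT (f \o phi) <-> p.-integrable setT f.
Proof.
move=> mf; have mfphi : measurable_fun setT (f \o phi) by exact: measurableT_comp.
have e : \int[m]_x `|f (phi x)| = \int[p]_y `|f y|.
  rewrite -(image_ge0_integral (f := fun y => `|f y|))//.
  exact: measurableT_comp.
by split=> /integrableP[_ h]; apply/integrableP; split => //; move: h; rewrite /= e.
Qed.

Lemma image_integral (f : T -> \bar R) : measurable_fun setT f ->
  \int[m]_x f (phi x) = \int[p]_y f y.
Proof.
move=> mf; rewrite [RHS]integralE [LHS]integralE; congr (_ - _).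
- rewrite -(image_ge0_integral (f := f^\+))//; first by rewrite funepos_comp.
  exact: measurable_funepos.
- rewrite -(image_ge0_integral (f := f^\-))//; first by rewrite funeneg_comp.
  exact: measurable_funeneg.
Qed.

End ImageMeasure.

Section Coupling.
Context (R : realType) (X Y : ptopologicalType).
Variables (rho : probability (borel X) R) (mu : probability (borel Y) R).
Variable g : probability (borel (X * Y)%type) R.
Hypothesis cg : coupling rho mu g.
Local Open Scope ereal_scope.

Let mfst := @measurable_fst_borel X Y.
Let msnd := @measurable_snd_borel X Y.

Lemma coupling_integrable_fst (f : X -> \bar R) :
  measurable_fun [set: borel X] f ->
  g.-integrable setT (f \o fst) <-> rho.-integrable setT f.
Proof. by move=> mf; apply: image_integrable => //; case: cg. Qed.

Lemma coupling_integrable_snd (f : Y -> \bar R) :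
  measurable_fun [set: borel Y] f ->
  g.-integrable setT (f \o snd) <-> mu.-integrable setT f.
Proof. by move=> mf; apply: image_integrable => //; case: cg. Qed.

Lemma coupling_integral_fst (f : X -> \bar R) :
  measurable_fun [set: borel X] f -> \int[g]_z f z.1 = \int[rho]_x f x.
Proof. by move=> mf; have [c1 _] := cg; exact: (image_integral (mfst) c1 mf). Qed.

Lemma coupling_integral_snd (f : Y -> \bar R) :
  measurable_fun [set: borel Y] f -> \int[g]_z f z.2 = \int[mu]_x f x.
Proof. by move=> mf; have [_ c2] := cg; exact: (image_integral (msnd) c2 mf). Qed.

Lemma coupling_integralD (f : X -> \bar R) (h : Y -> \bar R) :
  rho.-integrable setT f -> mu.-integrable setT h ->
  \int[g]_z (f z.1 + h z.2) = \int[rho]_x f x + \int[mu]_y h y.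
Proof.
move=> intf inth; have mf := measurable_int _ intf; have mh := measurable_int _ inth.
rewrite -coupling_integral_fst// -coupling_integral_snd//.
apply: integralD => //.
- exact/(coupling_integrable_fst mf).
- exact/(coupling_integrable_snd mh).
Qed.

Lemma coupling_integrableD (f : X -> \bar R) (h : Y -> \bar R) :
  rho.-integrable setT f -> mu.-integrable setT h ->
  g.-integrable setT (fun z => f z.1 + h z.2).
Proof.
move=> intf inth; have mf := measurable_int _ intf; have mh := measurable_int _ inth.
apply: integrableD => //.
- exact/(coupling_integrable_fst mf).
- exact/(coupling_integrable_snd mh).
Qed.

End Coupling.

Lemma continuous_measurable_EFin (R : realType) (T : ptopologicalType) (f : T -> R) :
  continuous f -> measurable_fun [set: borel T] (EFin \o f).
Proof.
move=> cf; apply: measurable_usc => t.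
suff -> : [set x | ((EFin \o f) x < t%:E)%E] = f @^-1` [set r | r < t].
  by apply: open_comp => [x _|]; [exact: cf|exact: open_lt].
by apply/seteqP; split => x /=; rewrite lte_fin.
Qed.

Section Ultrafilter.
Context (R : realType) (G : Type) (U : set_system G) (UF : UltraFilter U).

(** The image ultrafilter contains a compact interval, hence has a cluster point, and a cluster
    point of an ultrafilter is a limit. *)
Lemma ultra_bounded_cvg (f : G -> R) (M : R) : (forall g, `|f g| <= M) ->
  cvg (f @ U).
Proof.
move=> fM; have UP := @ultra_proper _ _ UF.
have /(_ (f @ U)) : compact `[- M, M] by exact: segment_compact.
case=> [|p [_ pcl]].
  by apply: (@filterE _ U) => g /=; rewrite in_itv /= -ler_norml.
apply/cvg_ex; exists p => V Vp.
have [//|nV] := in_ultra_setVsetC (f @^-1` V) UF.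
by have [r [nVr Vr]] := pcl (~` V) V nV Vp.
Qed.

End Ultrafilter.

(** * Existence of an optimal plan *)

Lemma probability_fine_bounded (R : realType) (T : ptopologicalType)
    (E : set T) (g : probability (borel T) R) :
  measurable (E : set (borel T)) -> `|fine (g E)| <= 1.
Proof.
move=> mE; have gE1 := probability_le1 g mE.
have fE : g E \is a fin_num by exact: fin_num_measure.
by rewrite ger0_norm ?fine_ge0 ?measure_ge0// -lee_fin fineK.
Qed.

Section LimitCoupling.
Context (R : realType) (X Y : ptopologicalType).
Variables (rho : probability (borel X) R) (mu : probability (borel Y) R).
Variables (B1 : nat -> set X) (B2 : nat -> set Y).
Hypotheses (b1 : open_base B1) (b2 : open_base B2).
Hypotheses (rho_reg : regular rho) (mu_reg : regular mu).
Let XY := borel (X * Y)%type.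
Variable U : set_system (probability XY R).
Hypotheses (UF : UltraFilter U) (Uc : U (coupling rho mu)).

Let UP : ProperFilter U := @ultra_proper _ _ UF.

(** The default 0 off the Borel sets, where the values of a measure are arbitrary, keeps the
    function nonnegative on every set, as a content must be. *)
Definition ultra_content (E : set (X * Y)) : R :=
  if pselect (measurable (E : set XY)) then lim ((fun g : probability XY R => fine (g E)) @ U) else 0.

Let is_cvg_content (E : set (X * Y)) : measurable (E : set XY) ->
  cvg ((fun g : probability XY R => fine (g E)) @ U).
Proof.
move=> mE; exact: (@ultra_bounded_cvg _ _ _ UF (fun g : probability XY R => fine (g E)) 1
  (fun g => probability_fine_bounded g mE)).
Qed.

Let cvg_content (E : set (X * Y)) : measurable (E : set XY) ->
  (fun g : probability XY R => fine (g E)) @ U --> ultra_content E.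
Proof.
by move=> mE; rewrite /ultra_content; case: pselect => // ?; exact: is_cvg_content.
Qed.

Let cvg_content_unique (E : set (X * Y)) (l : R) : measurable (E : set XY) ->
  (fun g : probability XY R => fine (g E)) @ U --> l -> ultra_content E = l.
Proof. by move=> mE h; exact: (cvg_unique (@Rhausdorff R) (cvg_content mE) h). Qed.

(** Convergence is claimed on rectangles alone: on other Borel sets [gs] may differ from
    [ultra_content], which is only finitely additive there. *)
Lemma limit_coupling : exists gs : probability XY R, coupling rho mu gs /\
  forall A B, measurable (A : set (borel X)) -> measurable (B : set (borel Y)) ->
    (fun g : probability XY R => fine (g (A `*` B))) @ U --> fine (gs (A `*` B)).
Proof.
have ge0 E : 0 <= ultra_content E.
  rewrite /ultra_content; case: pselect => // mE.
  apply: limr_ge; first exact: is_cvg_content.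
  by apply: nearW => g; apply: fine_ge0; exact: measure_ge0.
have addU : finitely_additive ultra_content.
  move=> E F mE mF EF0; apply: cvg_content_unique; first exact: measurableU.
  have -> : (fun g : probability XY R => fine (g (E `|` F))) =
      (fun g => fine (g E) + fine (g F)).
    by apply/funext => g; rewrite measureU// fineD//; exact: fin_num_measure.
  by apply: cvgD; exact: cvg_content.
have margin (E : set (X * Y)) (r : \bar R) : measurable (E : set XY) ->
    r \is a fin_num ->
    (forall g, coupling rho mu g -> g E = r) -> (ultra_content E)%:E = r.
  move=> mE rfin h; rewrite -[RHS]fineK//; congr EFin.
  apply: cvg_content_unique => //; apply: cvg_near_cst.
  by apply: filterS Uc => g /h ->.
have [gs [cgs hgs]] : exists gs : probability XY R, coupling rho mu gs /\
    forall A B, measurable (A : set (borel X)) -> measurable (B : set (borel Y)) ->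
    gs (A `*` B) = (ultra_content (A `*` B))%:E.
  apply: (@rect_content_extension R X Y rho mu) b1 b2 => //.
  - move=> A mA; apply: margin.
    + exact: measurable_setX_borel.
    + exact: fin_num_measure.
    + by move=> g [g1 _]; rewrite -g1// setXT.
  - move=> B mB; apply: margin.
    + exact: measurable_setX_borel.
    + exact: fin_num_measure.
    + by move=> g [_ g2]; rewrite -g2// setTX.
exists gs; split => // A B mA mB; rewrite hgs//=.
by apply: cvg_content; exact: measurable_setX_borel.
Qed.

End LimitCoupling.

(* Over rectangles [A k] these functions exhaust any nonnegative continuous
   function, and [min_max_step] makes their integrals functions of the masses of
   rectangles alone. *)
Fixpoint max_step (R : realType) (T : Type) (t : nat -> R) (A : nat -> set T)
    (n : nat) (z : T) : R :=
  if n is k.+1 then Num.max (max_step t A k z) (t k * \1_(A k) z) else 0.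

Section MaxStep.
Context (R : realType) (T : Type).
Implicit Types (t : nat -> R) (A : nat -> set T).

Lemma max_stepS t A n z :
  max_step t A n.+1 z = Num.max (max_step t A n z) (t n * \1_(A n) z).
Proof. by []. Qed.

Lemma max_step_ge0 t A n z : 0 <= max_step t A n z.
Proof. by elim: n => //= n IH; rewrite le_max IH. Qed.

Lemma min_max_step t A n (s : R) (B : set T) z : (forall k, 0 <= t k) -> 0 <= s ->
  Num.min (max_step t A n z) (s * \1_B z) =
  max_step (fun k => Num.min (t k) s) (fun k => A k `&` B) n z.
Proof.
move=> t0 s0; have sB0 : 0 <= s * \1_B z by rewrite mulr_ge0// indicE.
elim: n => [|n IH]; first by rewrite /= min_l.
rewrite !max_stepS -IH min_maxl; congr Num.max.
rewrite !indicE in_setI.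
case: (z \in A n); case: (z \in B); rewrite ?mulr1 ?mulr0//.
- by rewrite min_r.
- by rewrite min_l.
- by rewrite minxx.
Qed.

(** This is [max u v = u + v - min u v], where the minimum is again a [max_step] with [n] terms. It
    makes the maximum linear up to shorter functions of the same kind. *)
Lemma max_stepSE t A n z : (forall k, 0 <= t k) ->
  max_step t A n.+1 z = max_step t A n z + t n * \1_(A n) z -
    max_step (fun k => Num.min (t k) (t n)) (fun k => A k `&` A n) n z.
Proof.
move=> t0; rewrite max_stepS -min_max_step//.
by case: (leP (max_step t A n z) (t n * \1_(A n) z)) => _; lra.
Qed.

Lemma nondecreasing_max_step t A z : nondecreasing_seq (fun n => max_step t A n z).
Proof. by apply/nondecreasing_seqP => n; rewrite max_stepS le_max lexx. Qed.

End MaxStep.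

Section MaxStepIntegral.
Context (R : realType) (T : ptopologicalType).
Implicit Types (t : nat -> R) (A : nat -> set T).
Let bT := borel T.

Lemma measurable_max_step t A n : (forall k, measurable (A k : set bT)) ->
  measurable_fun [set: bT] (max_step t A n).
Proof.
move=> mA; elim: n => [|n IH].
  by rewrite (_ : max_step t A 0 = cst 0).
rewrite (_ : max_step _ _ _ = fun z => Num.max (max_step t A n z) (t n * \1_(A n) z)).
  by apply: measurable_maxr => //; apply: measurable_funM.
by apply/funext => z; rewrite max_stepS.
Qed.

Lemma integrable_step (g : probability bT R) (s : R) (B : set T) :
  measurable (B : set bT) -> g.-integrable setT (fun z => (s * \1_B z)%:E).
Proof.
move=> mB.
exact: (integrableZl measurableT s (integrable_indic g mB)).
Qed.

Lemma integrable_max_step (g : probability bT R) t A n : (forall k, 0 <= t k) ->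
  (forall k, measurable (A k : set bT)) ->
  g.-integrable setT (fun z => (max_step t A n z)%:E).
Proof.
move=> t0 mA; elim: n => [|n IH].
  exact: integrable0.
apply: (le_integrable _ _ _ (integrableD _ IH (integrable_step g (t n) (mA n)))) => //.
  by apply/measurable_EFinP; exact: measurable_max_step.
move=> z _; have tA0 : 0 <= t n * \1_(A n) z by rewrite mulr_ge0.
rewrite /= lee_fin ger0_norm ?le_max ?max_step_ge0//.
rewrite ger0_norm ?addr_ge0 ?max_step_ge0//.
by rewrite ge_max lerDl lerDr max_step_ge0 tA0.
Qed.

(** By [max_stepSE] the integral is a combination of one mass and two integrals with fewer terms.
    The heights and sets of the subtracted one are new, so the induction keeps [t] and [A] general,
    and [C] has to be closed under intersection. *)
Lemma max_step_integral_cvg (U : set_system (probability bT R)) (gs : probability bT R)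
    (C : set (set T)) :
  Filter U -> setI_closed C -> C `<=` (@measurable _ bT) ->
  (forall E, C E -> (fun g : probability bT R => fine (g E)) @ U --> fine (gs E)) ->
  forall n t A, (forall k, 0 <= t k) -> (forall k, C (A k)) ->
  (fun g : probability bT R => \int[g]_z (max_step t A n z))%R @ U --> (\int[gs]_z (max_step t A n z))%R.
Proof.
move=> UF CI mC hC; elim=> [|n IH] t A t0 CA.
  have e (g : probability bT R) : (\int[g]_z (max_step t A 0 z))%R = 0.
    by rewrite Rintegral_cst//= mul0r.
  rewrite e; apply: cvg_near_cst; apply: nearW => g; exact: e.
have mA k : measurable (A k : set bT) by exact: mC.
pose t' k := Num.min (t k) (t n); pose A' k := A k `&` A n.
have t'0 k : 0 <= t' k by rewrite le_min !t0.
have CA' k : C (A' k) by exact: CI.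
have mA' k : measurable (A' k : set bT) by exact: mC.
have e (g : probability bT R) : (\int[g]_z (max_step t A n.+1 z))%R =
    \int[g]_z (max_step t A n z) + t n * fine (g (A n)) - \int[g]_z (max_step t' A' n z).
  under eq_Rintegral do rewrite max_stepSE//.
  rewrite RintegralB//; last 2 first.
  - exact: (integrableD measurableT (integrable_max_step g n t0 mA) (integrable_step g (t n) (mA n))).
  - exact: integrable_max_step.
  rewrite RintegralD//; last 2 first.
  - exact: integrable_max_step.
  - exact: integrable_step.
  congr (_ + _ - _).
  rewrite RintegralZl//; last exact: integrable_indic.
  by rewrite /Rintegral integral_indic// setIT.
rewrite e; under eq_cvg do rewrite e.
apply: cvgB; last exact: IH.
apply: cvgD; first exact: IH.
by apply: cvgMr; exact: hC.
Qed.

End MaxStepIntegral.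

(** All pairs of a base rectangle and a rational height are enumerated; a height is kept if it is
    nonnegative and [f] is at least that large on the rectangle, and replaced by 0 otherwise.
    Continuity at [z] provides a kept pair as close to [f z] as desired. *)
Lemma max_step_approx (R : realType) (X Y : ptopologicalType)
    (B1 : nat -> set X) (B2 : nat -> set Y) (f : X * Y -> R) :
  open_base B1 -> open_base B2 -> continuous f -> (forall z, 0 <= f z) ->
  exists (t : nat -> R) (A : nat -> set (X * Y)),
    [/\ forall k, 0 <= t k, forall k, @rectangles X Y (A k),
      forall n z, max_step t A n z <= f z &
      forall z e, 0 < e -> exists n, f z - e < max_step t A n z].
Proof.
move=> b1 b2 cf f0; have [B [ob1 ob2 [oB bB]]] := open_base_prod b1 b2.
pose i_ k := (odflt (0%N, 0%Q) (unpickle k) : nat * rat).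
pose A k := (B (i_ k).1).1 `*` (B (i_ k).1).2.
pose t k : R := if pselect (0 <= ratr (i_ k).2 :> R /\
  forall z, A k z -> ratr (i_ k).2 <= f z) then ratr (i_ k).2 else 0.
have t0 k : 0 <= t k by rewrite /t; case: pselect => [[]|].
exists t, A; split => //.
- move=> k; exists (B (i_ k).1).1, (B (i_ k).1).2; split => //; exact: open_borel.
- elim=> [|n IH] z; first exact: f0.
  rewrite /= ge_max IH /= /t indicE; case: pselect => [[q0 qf]|h1]; last by rewrite mul0r.
  by case: (boolP (z \in A n)) => [/set_mem/qf|_]; rewrite ?mulr1 ?mulr0.
- move=> z e e0; have [fe|fe] := ltP (f z) e.
    by exists 0%N => /=; rewrite subr_lt0.
  have : f z - e < f z by rewrite ltrBlDr ltrDl.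
  move=> /rat_in_itvoo[q]; rewrite in_itv /= => /andP[q1 q2].
  have oq : open [set u | ratr q < f u].
    by apply: (open_comp (f := f) (D := [set r | ratr q < r])) => [x _|]; [exact: cf|exact: open_gt].
  have [i [Biz iq]] := bB _ z oq q2.
  exists (pickle (i, q)).+1; rewrite /= lt_max; apply/orP; right.
  have ik : i_ (pickle (i, q)) = (i, q) by rewrite /i_ pickleK.
  have Az : A (pickle (i, q)) z by rewrite /A ik.
  rewrite indicE mem_set// mulr1 /t; case: pselect => [h1|]; first by rewrite /= ik.
  case; split; first by rewrite ik /=; apply: le_trans (ltW q1); rewrite subr_ge0.
  by move=> u; rewrite /A ik /= => /iq/= /ltW.
Qed.

Section LowerSemicontinuity.
Context (R : realType) (X Y : ptopologicalType).
Variables (B1 : nat -> set X) (B2 : nat -> set Y).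
Hypotheses (b1 : open_base B1) (b2 : open_base B2).
Let XY := borel (X * Y)%type.
Variables (U : set_system (probability XY R)) (gs : probability XY R).
Hypothesis UF : ProperFilter U.
Hypothesis Ugs : forall A B, measurable (A : set (borel X)) ->
  measurable (B : set (borel Y)) ->
  (fun g : probability XY R => fine (g (A `*` B))) @ U --> fine (gs (A `*` B)).

(** Lower semicontinuity of the integral under convergence on rectangles: the integral of each
    [max_step] below [f] does converge along [U] and stays below [v], and monotone convergence under
    [gs] reaches [f]. *)
Lemma integral_le_limit (f : X * Y -> R) (v : R) :
  continuous f -> (forall z, 0 <= f z) ->
  U [set g : probability XY R | (\int[g]_z (f z)%:E <= v%:E)%E] ->
  (\int[gs]_z (f z)%:E <= v%:E)%E.
Proof.
move=> cf f0 Uv; have [t [A [t0 rA Af fA]]] := max_step_approx b1 b2 cf f0.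
have mf : measurable_fun [set: XY] (EFin \o f) by exact: continuous_measurable_EFin.
have mA k : measurable (A k : set XY).
  by have [A1 [A2 [mA1 mA2 ->]]] := rA k; exact: measurable_setX_borel.
have ms n : measurable_fun [set: XY] (fun z => (max_step t A n z)%:E).
  by apply/measurable_EFinP; exact: measurable_max_step.
have lim_ms z : limn (fun n => (max_step t A n z)%:E) = (f z)%:E.
  apply/cvg_lim => //; apply/fine_cvgP; split; first exact: nearW.
  apply/cvgrPdist_le => e e0; have [n fn] := fA z e e0.
  near=> m; rewrite /= ger0_norm ?subr_ge0// lerBlDr addrC -lerBlDr.
  apply: (le_trans (ltW fn)); apply: nondecreasing_max_step; near: m.
  exact: nbhs_infty_ge.
have -> : (\int[gs]_z (f z)%:E = \int[gs]_z limn (fun n => (max_step t A n z)%:E))%E.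
  by apply: eq_integral => z _; rewrite lim_ms.
rewrite monotone_convergence//; last 2 first.
- by move=> n z _; rewrite lee_fin max_step_ge0.
- by move=> z _ n m nm; rewrite lee_fin; exact: nondecreasing_max_step.
have ims (g : probability XY R) n : (\int[g]_z (max_step t A n z)%:E)%E =
    ((\int[g]_z max_step t A n z)%R)%:E.
  rewrite fineK//; apply: integrable_fin_num => //; exact: integrable_max_step.
apply: lime_le.
  apply: ereal_nondecreasing_is_cvgn => n m nm; apply: ge0_le_integral => //.
  - by move=> z _; rewrite lee_fin max_step_ge0.
  - by move=> z _; rewrite lee_fin; exact: nondecreasing_max_step.
apply: nearW => n; rewrite ims lee_fin.
have cv : (fun g : probability XY R => \int[g]_z max_step t A n z)%R @ U -->
    (\int[gs]_z max_step t A n z)%R.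
  apply: (max_step_integral_cvg (C := @rectangles X Y)) => //.
  - exact: rectanglesI.
  - by move=> _ [A1 [A2 [mA1 mA2 ->]]]; exact: measurable_setX_borel.
  - by move=> _ [A1 [A2 [mA1 mA2 ->]]]; exact: Ugs.
rewrite -(cvg_lim (@Rhausdorff R) cv); apply: limr_le; first by apply/cvg_ex; eexists; exact: cv.
apply: filterS Uv => g /= fv; rewrite -lee_fin -ims; apply: le_trans fv.
apply: ge0_le_integral => //.
- by move=> z _; rewrite lee_fin max_step_ge0.
- by move=> z _; rewrite lee_fin.
Unshelve. all: by end_near. Qed.

End LowerSemicontinuity.

Lemma tail_integral_cvg0 (R : realType) (T : ptopologicalType)
    (m : probability (borel T) R) (a : T -> R) :
  m.-integrable setT (EFin \o a) ->
  ((\int[m]_x (Num.max (a x - n%:R) 0)%:E)%E @[n --> \oo] --> 0%E).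
Proof.
move=> ia; have ma := measurable_int _ ia.
have ma' : measurable_fun [set: borel T] a by exact/measurable_EFinP.
have mf n : measurable_fun [set: borel T] (fun x => (Num.max (a x - n%:R) 0)%:E).
  by apply/measurable_EFinP; apply: measurable_maxr => //; exact: measurable_funB.
have [] := @dominated_convergence _ _ _ m setT measurableT
  (fun n x => (Num.max (a x - n%:R) 0)%:E) (cst 0%E) (abse \o (EFin \o a)) mf.
- exact: measurable_cst.
- apply: aeW => x _; apply: cvg_near_cst; near=> n; congr EFin.
  apply: max_r; rewrite subr_le0; near: n; exact: nbhs_infty_ger.
- exact: integrable_abse.
- apply: aeW => x n _; rewrite /= lee_fin ger0_norm ?le_max ?lexx ?orbT//.
  by rewrite ge_max normr_ge0 andbT lerBlDr (le_trans (ler_norm _))// lerDl.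
- by move=> _ _; rewrite integral_cst// mul0e.
Unshelve. all: by end_near. Qed.

(** The product measure, carried over to the Borel sets of the product space. The first factor is a
    general measure because the exchange along a cycle uses one of mass [w]. *)
Lemma exists_coupling (R : realType) (X Y : ptopologicalType)
    (B1 : nat -> set X) (B2 : nat -> set Y)
    (p : {measure set (borel X) -> \bar R})
    (q : {sigma_finite_measure set (borel Y) -> \bar R}) :
  open_base B1 -> open_base B2 ->
  exists m : {measure set (borel (X * Y)%type) -> \bar R},
    forall A B, measurable (A : set (borel X)) -> measurable (B : set (borel Y)) ->
    m (A `*` B) = (p A * q B)%E.
Proof.
move=> b1 b2.
have mid : measurable_fun setT
    (id : (borel X * borel Y)%type -> borel (X * Y)%type).
  move=> _ E mE; rewrite setTI preimage_id.
  move: mE; rewrite (borel_prodE b1 b2); apply: smallest_sub => //.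
    exact: sigma_algebra_measurable.
  by move=> _ [A [B [mA mB ->]]]; exact: measurableX.
have [m hm] := exists_pushforward (p \x q)%E mid.
by exists m => A B mA mB; rewrite hm preimage_id; exact: product_measure1E.
Qed.

Section ExistencePlan.
Context (R : realType) (X Y : ptopologicalType).
Variables (rho : probability (borel X) R) (mu : probability (borel Y) R).
Variables (B1 : nat -> set X) (B2 : nat -> set Y).
Hypotheses (b1 : open_base B1) (b2 : open_base B2).
Hypotheses (rho_reg : regular rho) (mu_reg : regular mu).
Variables (c : X * Y -> R) (a : X -> R) (b : Y -> R).
Hypotheses (cc : continuous c) (ia : rho.-integrable setT (EFin \o a))
  (ib : mu.-integrable setT (EFin \o b))
  (cab : forall x y, `|c (x, y)| <= a x + b y).
Let XY := borel (X * Y)%type.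

Lemma product_coupling : exists g : probability XY R, coupling rho mu g.
Proof.
have [m hm] := @exists_coupling R X Y B1 B2 rho mu b1 b2.
have m1 : m setT = 1%E.
  by rewrite -setXTT hm//; rewrite [X in (X * _)%E]probability_setT [X in (_ * X)%E]probability_setT mule1.
have [g hg] := exists_probability m1; exists g; split => [A mA|B mB].
- by rewrite -setXT hg hm// [X in (_ * X)%E]probability_setT mule1.
- by rewrite -setTX hg hm// [X in (X * _)%E]probability_setT mul1e.
Qed.

Lemma cost_integrable (g : probability XY R) : coupling rho mu g ->
  g.-integrable setT (EFin \o c).
Proof.
move=> cg; apply: (le_integrable _ _ _ (coupling_integrableD cg ia ib)) => //.
  exact: continuous_measurable_EFin.
move=> [x y] _; rewrite /= lee_fin; apply: le_trans (cab x y) _.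
exact: ler_norm.
Qed.

Lemma cost_fin_num (g : probability XY R) : coupling rho mu g -> cost c g \is a fin_num.
Proof. by move=> cg; apply: integrable_fin_num => //; exact: cost_integrable. Qed.

Let tail n : \bar R := (\int[rho]_x (Num.max (a x - n%:R) 0)%:E +
  \int[mu]_y (Num.max (b y - n%:R) 0)%:E)%E.

(** The shift is by [2 n] because [c + 2 n >= (n - a) + (n - b)]: the negative part that is cut off
    is at most the sum of the parts of [a] and [b] above [n], which [tail n] integrates. *)
Let trunc n z : R := Num.max (c z + n%:R *+ 2) 0.

Let tail_integrable (T : ptopologicalType) (m : probability (borel T) R)
    (u : T -> R) n : m.-integrable setT (EFin \o u) ->
  m.-integrable setT (fun x => (Num.max (u x - n%:R) 0)%:E).
Proof.
move=> iu; have mu_ := measurable_int _ iu.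
apply: (le_integrable _ _ _ iu) => //.
  by apply/measurable_EFinP; apply: measurable_maxr => //; apply: measurable_funB => //; exact/measurable_EFinP.
move=> x _; rewrite /= lee_fin ger0_norm ?le_max ?lexx ?orbT//.
by rewrite ge_max normr_ge0 andbT lerBlDr (le_trans (ler_norm _))// lerDl.
Qed.

Let tail_fin n : tail n \is a fin_num.
Proof.
by rewrite /tail fin_numD; apply/andP; split; apply: integrable_fin_num => //;
  exact: tail_integrable.
Qed.

Let bound_fin (g : probability XY R) n (r : R) : coupling rho mu g ->
  (cost c g + r%:E + tail n)%E \is a fin_num.
Proof. by move=> cg; rewrite fin_numD tail_fin andbT fin_numD cost_fin_num. Qed.

Let cst_integrable (g : probability XY R) (r : R) :
  g.-integrable setT (fun z => r%:E).
Proof. exact: finite_measure_integrable_cst. Qed.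

Let cost_addr (g : probability XY R) (r : R) : coupling rho mu g ->
  (\int[g]_z ((c z)%:E + r%:E) = cost c g + r%:E)%E.
Proof.
move=> cg.
apply: etrans (integralD measurableT (cost_integrable cg) (cst_integrable g r)) _.
by rewrite integral_cst// [X in (_ * X)%E]probability_setT mule1.
Qed.

Let trunc_le (g : probability XY R) n : coupling rho mu g ->
  (\int[g]_z (trunc n z)%:E <= cost c g + (n%:R *+ 2)%:E + tail n)%E.
Proof.
move=> cg; have i1 := cost_integrable cg.
have i2 := coupling_integrableD cg (tail_integrable n ia) (tail_integrable n ib).
have i12 := integrableD measurableT i1 (cst_integrable g (n%:R *+ 2)).
rewrite /tail -(coupling_integralD cg (tail_integrable n ia) (tail_integrable n ib)).
rewrite -cost_addr//.
rewrite -(integralD measurableT i12 i2); apply: ge0_le_integral => //.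
- by move=> z _; rewrite lee_fin le_max lexx orbT.
- apply/measurable_EFinP; apply: measurable_maxr => //.
  apply: measurable_funD => //; apply/measurable_EFinP.
  exact: continuous_measurable_EFin.
- exact: (measurable_int _ (integrableD measurableT i12 i2)).
move=> [x y] _; rewrite /trunc -!EFinD lee_fin.
have := cab x y; rewrite ler_norml => /andP[h1 h2].
rewrite ge_max; apply/andP; split.
  by rewrite lerDl addr_ge0// le_max lexx orbT.
have h3 : a x - n%:R <= Num.max (a x - n%:R) 0 by rewrite le_max lexx.
have h4 : b y - n%:R <= Num.max (b y - n%:R) 0 by rewrite le_max lexx.
move: h1 h3 h4; set M1 := Num.max _ _; set M2 := Num.max _ _.
by rewrite mulr2n; lra.
Qed.

Let le_trunc (g : probability XY R) n : coupling rho mu g ->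
  (cost c g + (n%:R *+ 2)%:E <= \int[g]_z (trunc n z)%:E)%E.
Proof.
move=> cg; have i1 := cost_integrable cg.
have i12 := integrableD measurableT i1 (cst_integrable g (n%:R *+ 2)).
rewrite -cost_addr//.
apply: le_integral => //; last by move=> z _; rewrite -EFinD lee_fin le_max lexx.
apply: (le_integrable _ _ _ i12) => //.
  apply/measurable_EFinP; apply: measurable_maxr => //.
  apply: measurable_funD => //; apply/measurable_EFinP.
  exact: continuous_measurable_EFin.
move=> z _; rewrite /= lee_fin ger0_norm ?le_max ?lexx ?orbT//.
by rewrite ge_max ler_norm normr_ge0.
Qed.

(** The couplings that cost no more than a given one form a filter base as the given one varies. An
    ultrafilter containing these sets replaces a minimising sequence and is eventually below the
    cost of every competitor [g0]. *)
Theorem exists_optimal_plan : exists g : probability XY R, optimal_plan rho mu c g.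
Proof.
pose F : set_system (probability XY R) := filter_from (coupling rho mu)
  (fun g0 => [set g | coupling rho mu g /\ (cost c g <= cost c g0)%E]).
have FF : ProperFilter F.
  apply: filter_from_proper; last by move=> g cg; exists g; split.
  apply: filter_from_filter; first exact: product_coupling.
  move=> g1 g2 c1 c2; have [g12|/ltW g21] := leP (cost c g1) (cost c g2).
    by exists g1 => // g [cg h]; split; split => //; exact: le_trans g12.
  by exists g2 => // g [cg h]; split; split => //; exact: le_trans g21.
have [U [UF FU]] := ultraFilterLemma FF.
have UP : ProperFilter U by exact: ultra_proper.
have Uc : U (coupling rho mu).
  have [g0 cg0] := product_coupling; apply: FU; exists g0 => //.
  by move=> g [].
have [gs [cgs hgs]] := limit_coupling b1 b2 rho_reg mu_reg UF Uc.
exists gs; split => // g0 cg0.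
(* [trunc n] is nonnegative, so its integral passes to the limit; the shift by [2 n] occurs on both
   sides and cancels, leaving only [tail n]. *)
have key n : (cost c gs <= cost c g0 + tail n)%E.
  have : (\int[gs]_z (trunc n z)%:E <= (fine (cost c g0 + (n%:R *+ 2)%:E + tail n))%:E)%E.
    apply: (integral_le_limit b1 b2 UP hgs).
    - apply: max_fun_continuous; last exact: cst_continuous.
      by move=> z; apply: cvgD; [exact: cc|exact: cvg_cst].
    - by move=> z; rewrite le_max lexx orbT.
    apply: FU; exists g0 => // g [cg gg0] /=.
    rewrite fineK ?bound_fin//.
    apply: le_trans (trunc_le n cg) _.
    by rewrite leeD2r// leeD2r.
  rewrite fineK ?bound_fin//.
  move=> /(le_trans (le_trunc n cgs)); rewrite (addeAC (cost c g0)) leeD2rE//.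
have tail0 : tail @ \oo --> 0%E.
  rewrite -[0%E]adde0; apply: cvgeD => //; exact: tail_integral_cvg0.
have cv : (fun n => cost c g0 + tail n)%E @ \oo --> cost c g0.
  rewrite -[X in _ --> X]adde0; apply: cvgeD => //; last exact: cvg_cst.
  by rewrite fin_num_adde_defl.
rewrite -(cvg_lim _ cv)//; apply: lime_ge; first by apply/cvg_ex; eexists; exact: cv.
by apply: nearW => n; exact: key.
Qed.

End ExistencePlan.

(** * Cyclical monotonicity of optimal plans *)

Section MeasureDifference.
Context (d : measure_display) (T : measurableType d) (R : realType).
Variables (g : probability T R) (s : {measure set T -> \bar R}).
Hypothesis sg : forall E, measurable E -> (s E <= g E)%E.
Local Open Scope ereal_scope.

Lemma dominated_fin_num E : measurable E -> s E \is a fin_num.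
Proof.
move=> mE; rewrite ge0_fin_numE//; apply: le_lt_trans (sg mE) _.
by rewrite -ge0_fin_numE//; exact: fin_num_measure.
Qed.

(** On measurable sets [s] is finite and below [g], so the difference makes sense; elsewhere the
    measure is set to 0. The sum form of the conclusion avoids subtraction in the extended reals. *)
Lemma exists_measure_difference : exists m : {measure set T -> \bar R},
  forall E, measurable E -> m E + s E = g E.
Proof.
pose P E := if pselect (measurable E) then g E - s E else 0.
have PE E : measurable E -> P E = g E - s E by rewrite /P; case: pselect.
have [|||m hm] := @exists_measure d T R P.
- by rewrite PE// !measure0 sube0.
- move=> E; rewrite /P; case: pselect => // mE.
  by rewrite sube_ge0 ?dominated_fin_num//; exact: sg.
- move=> F mF tF mUF; rewrite PE//.
  rewrite [X in X @ _](_ : _ =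
      (fun n => \sum_(0 <= i < n) g (F i) - \sum_(0 <= i < n) s (F i))).
    apply: cvgeB; [|exact: measure_semi_sigma_additive|exact: measure_semi_sigma_additive].
    by apply: fin_num_adde_defl; rewrite fin_numN dominated_fin_num.
  apply/funext => n; elim: n => [|n IH]; first by rewrite !big_geq// sube0.
  rewrite !big_nat_recr//= IH PE// fin_num_oppeD ?dominated_fin_num//.
  by rewrite addeACA.
- exists m => E mE; rewrite hm PE// subeK//; exact: dominated_fin_num.
Qed.

End MeasureDifference.

Section IntegralConcentrated.
Context (d : measure_display) (T : measurableType d) (R : realType).
Variables (m : {measure set T -> \bar R}) (W : set T) (f : T -> R) (w l u : R).
Hypotheses (mW : measurable W) (mWC : m (~` W) = 0%E) (mT : m setT = w%:E).
Hypotheses (mf : measurable_fun setT f) (fW : forall z, W z -> l <= f z <= u).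
Local Open Scope ereal_scope.

Let mWw : m W = w%:E.
Proof.
have e : m (W `|` ~` W) = m W + m (~` W).
  by rewrite measureU//; [exact: measurableC|exact: setICr].
by rewrite -mT -(setUv W) e mWC adde0.
Qed.

Let iW : m.-integrable W (EFin \o f).
Proof.
apply: measurable_bounded_integrable => //.
- by rewrite mWw ltry.
- exact: measurable_funS mf.
- exists (`|l| + `|u|)%R; split; first exact: num_real.
  move=> r hr z Wz; apply: le_trans (ltW hr).
  have /andP[h1 h2] := fW Wz; rewrite ler_norml; apply/andP; split.
    have h3 := ler_norm (- l); rewrite normrN in h3; have h4 := normr_ge0 u; lra.
  by have h3 := ler_norm u; have h4 := normr_ge0 l; lra.
Qed.

Lemma integrable_concentrated : m.-integrable setT (EFin \o f).
Proof.
apply/(negligible_integrable (N := ~` W)) => //; first exact: measurableC.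
  exact/measurable_EFinP.
by rewrite setTD setCK.
Qed.

Lemma integral_concentrated :
  (l * w)%:E <= \int[m]_z (f z)%:E <= (u * w)%:E.
Proof.
rewrite (negligible_integral (N := ~` W))//; last 2 first.
- exact: measurableC.
- exact: integrable_concentrated.
rewrite setTD setCK.
have icst r : m.-integrable W (fun=> r%:E).
  have := @measurable_bounded_integrable _ _ _ m (cst r) W mW; apply => //.
  - by rewrite mWw ltry.
  - by exists `|r|%R; split; [exact: num_real|move=> x hx z _; exact: ltW].
have cstE r : \int[m]_(z in W) (r%:E) = (r * w)%:E.
  by rewrite integral_cst// mWw.
by rewrite -!cstE; apply/andP; split; apply: le_integral => // z /set_mem Wz;
  rewrite lee_fin; have /andP[] := fW Wz.
Qed.

End IntegralConcentrated.

Lemma integral_msum (d : measure_display) (T : measurableType d) (R : realType)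
    (m : nat -> {measure set T -> \bar R}) (f : T -> \bar R) n :
  (forall i, (m i).-integrable setT f) ->
  (msum m n).-integrable setT f /\
  (\int[msum m n]_z f z = \sum_(i < n) \int[m i]_z f z)%E.
Proof.
move=> imf; have mf := measurable_int _ (imf 0%N).
elim: n => [|n [IH1 IH2]].
  have e : forall h : T -> \bar R, (\int[msum m 0]_z h z = 0)%E.
    move=> h; rewrite (eq_measure_integral mzero) ?integral_measure_zero//.
    by move=> A _ _; rewrite /= /msum big_ord0.
  by rewrite big_ord0 e; split => //; apply/integrableP; split; rewrite ?e.
have e (h : T -> \bar R) : (\int[msum m n.+1]_z h z =
    \int[measure_add (msum m n) (m n)]_z h z)%E.
  apply: eq_measure_integral => A _ _.
  by apply: etrans (esym (measure_addE _ _ A)); rewrite /= /msum big_ord_recr.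
split; last by rewrite e integral_measure_add// IH2 big_ord_recr.
apply/integrableP; split => //; rewrite e ge0_integral_measure_add//; last first.
  exact: measurableT_comp.
apply: lte_add_pinfty.
- by have /integrableP[] := IH1.
- by have /integrableP[] := imf n.
Qed.

Section Exchange.
Context (R : realType) (X Y : ptopologicalType).
Variables (rho : probability (borel X) R) (mu : probability (borel Y) R).
Variables (c : X * Y -> R) (a : X -> R) (b : Y -> R).
Hypotheses (cc : continuous c) (ia : rho.-integrable setT (EFin \o a))
  (ib : mu.-integrable setT (EFin \o b))
  (cab : forall x y, `|c (x, y)| <= a x + b y).
Let XY := borel (X * Y)%type.
Variable g : probability XY R.
Hypothesis og : optimal_plan rho mu c g.
Local Open Scope ereal_scope.

(** Replacing the part [s] of [g] by [t] gives the competitor [g - s + t], a coupling since [s] and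
    [t] have the same marginals. The integral of [c] against [g - s] is finite and cancels from the
    comparison. *)
Lemma optimal_plan_exchange (s t : {measure set XY -> \bar R}) :
  (forall E, measurable (E : set XY) -> s E <= g E) ->
  (forall A, measurable (A : set (borel X)) -> s (A `*` setT) = t (A `*` setT)) ->
  (forall B, measurable (B : set (borel Y)) -> s (setT `*` B) = t (setT `*` B)) ->
  t.-integrable setT (EFin \o c) ->
  \int[s]_z (c z)%:E <= \int[t]_z (c z)%:E.
Proof.
move=> sg st1 st2 it; have [cg opt] := og.
have mc : measurable_fun [set: XY] (EFin \o c) by exact: continuous_measurable_EFin.
have [m hm] := exists_measure_difference sg.
have ig : g.-integrable setT (EFin \o c) by exact: (cost_integrable cc ia ib cab cg).
have sub (n : {measure set XY -> \bar R}) :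
    (forall E, measurable (E : set XY) -> n E <= g E) -> n.-integrable setT (EFin \o c).
  move=> ng; have /integrableP[_ h] := ig; apply/integrableP; split => //.
  apply: le_lt_trans h; apply: ge0_le_measure_integral => //.
  exact: measurableT_comp.
have is_ : s.-integrable setT (EFin \o c) by exact: sub.
have im : m.-integrable setT (EFin \o c).
  by apply: sub => E mE; rewrite -hm// leeDl.
have intg : \int[g]_z (c z)%:E = \int[m]_z (c z)%:E + \int[s]_z (c z)%:E.
  rewrite -(integral_measure_add _ im is_)//; apply: eq_measure_integral => E mE _.
  by apply: etrans (esym (measure_addE _ _ E)); rewrite hm.
have add1 : measure_add m t setT = 1.
  apply: etrans (measure_addE _ _ _) _.
  by rewrite -setXTT -st1// hm; [rewrite setXTT; exact: probability_setT|exact: measurable_setX_borel].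
have [g' hg'] := exists_probability add1.
have g'E E : g' E = m E + t E by rewrite hg'; exact: measure_addE.
have cg' : coupling rho mu g'.
  split=> [A mA|B mB].
  - rewrite g'E -setXT -st1// hm; last exact: measurable_setX_borel.
    by rewrite setXT; case: cg => + _; exact.
  - rewrite g'E -setTX -st2// hm; last exact: measurable_setX_borel.
    by rewrite setTX; case: cg => _; exact.
have intg' : \int[g']_z (c z)%:E = \int[m]_z (c z)%:E + \int[t]_z (c z)%:E.
  rewrite -(integral_measure_add _ im it)//; apply: eq_measure_integral => E mE _.
  exact: hg'.
have := opt _ cg'; rewrite /cost intg intg' leeD2lE//.
exact: integrable_fin_num.
Qed.

End Exchange.

Lemma exists_restr_scaled (d : measure_display) (T : measurableType d) (R : realType)
    (g : {measure set T -> \bar R}) (W : set T) (r : R) :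
  measurable W -> 0 <= r ->
  exists m : {measure set T -> \bar R}, forall E, m E = (r%:E * g (E `&` W))%E.
Proof. by move=> mW r0; exists (mscale (NngNum r0) (mrestr g mW)). Qed.

Section CyclicalMonotonicity.
Context (R : realType) (X Y : ptopologicalType).
Variables (rho : probability (borel X) R) (mu : probability (borel Y) R).
Variables (B1 : nat -> set X) (B2 : nat -> set Y).
Hypotheses (b1 : open_base B1) (b2 : open_base B2).
Variables (c : X * Y -> R) (a : X -> R) (b : Y -> R).
Hypotheses (cc : continuous c) (ia : rho.-integrable setT (EFin \o a))
  (ib : mu.-integrable setT (EFin \o b))
  (cab : forall x y, `|c (x, y)| <= a x + b y).
Let XY := borel (X * Y)%type.
Variable g : probability XY R.
Hypothesis og : optimal_plan rho mu c g.

Let neighbourhood (w : X * Y) (e : R) : 0 < e ->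
  exists UV : set X * set Y, [/\ open UV.1, open UV.2, UV.1 w.1, UV.2 w.2 &
    forall x y, UV.1 x -> UV.2 y -> `|c (x, y) - c w| <= e].
Proof.
move=> e0; have [B [ob1 ob2 [_ bB]]] := open_base_prod b1 b2.
have oc : open [set v | `|c v - c w| < e].
  apply: (open_comp (f := fun v => `|c v - c w|) (D := [set r | r < e])); last exact: open_lt.
  by move=> v _; apply: cvg_norm; apply: cvgB; [exact: cc|exact: cvg_cst].
have [|i [[Bw1 Bw2] Bi]] := bB _ w oc; first by rewrite /= subrr normr0.
exists (B i); split => // x y Bx By.
by apply: ltW; apply: (Bi (x, y)).
Qed.

Theorem spt_cyclically_monotone k (z : nat -> X * Y) :
  (forall i, spt (T := (X * Y)%type) g (z i)) -> z k.+1 = z 0%N ->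
  0 <= \sum_(0 <= i < k.+1) (c ((z i.+1).1, (z i).2) - c (z i)).
Proof.
move=> zg zk; rewrite leNgt; apply/negP => S0.
set S := \sum_(0 <= i < k.+1) _ in S0.
(* Each of the [k.+1] points costs an error [e] on either side of the comparison, in total
   [- S / 2], which is less than the gain [- S]. *)
pose e : R := - S / (k.+1%:R *+ 4).
have e0 : 0 < e by rewrite divr_gt0 ?oppr_gt0// pmulrn_lgt0.
(* The mass [w] that [sg i] takes away near [z i] is put back by [tg i] near
   [(x_(i+1), y_i)]: the marginals of [sg] and [tg] agree after summing over the
   cycle, and [c] oscillates by at most [e] on all these neighbourhoods. *)
have /choice[N hN] i := @neighbourhood (z i) e e0.
have /choice[N' hN'] i := @neighbourhood ((z i.+1).1, (z i).2) e e0.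
(* [p] and [s] are predecessor and successor modulo [k.+1]. The set [U i] around [x_i] must suit
   both the old location [z i] and the new location [(x_i, y_(p i))], whose neighbourhood has index
   [p i]. *)
pose p i := if i is j.+1 then j else k.
pose s i := if i == k then 0%N else i.+1.
pose U i := (N i).1 `&` (N' (p i)).1.
pose V i := (N i).2 `&` (N' i).2.
have zs i : (i < k.+1)%N -> z (s i) = z i.+1.
  by rewrite /s; case: eqP => [->|//]; rewrite zk.
have ps i : p (s i) = i by rewrite /s; case: eqP => [->|].
have zp i : z (p i).+1 = z i by case: i.
have oU i : open (U i) by apply: openI; [have [] := hN i|have [] := hN' (p i)].
have oV i : open (V i) by apply: openI; [have [] := hN i|have [] := hN' i].
have Uz i : U i (z i).1.
  split; first by have [] := hN i.
  by have [_ _ + _ _] := hN' (p i); rewrite /= zp.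
have Vz i : V i (z i).2.
  by split; [have [] := hN i|have [] := hN' i].
pose W i := U i `*` V i.
have mU i : measurable (U i : set (borel X)) by exact: open_borel.
have mV i : measurable (V i : set (borel Y)) by exact: open_borel.
have mW i : measurable (W i : set XY) by exact: measurable_setX_borel.
have W0 i : (0 < g (W i))%E.
  by apply: (zg i); [exact: open_setX|split; [exact: Uz|exact: Vz]].
pose m i := fine (g (W i)).
have mE i : g (W i) = (m i)%:E by rewrite fineK//; exact: fin_num_measure.
have m0 i : 0 < m i by rewrite -lte_fin -mE.
(* This choice gives the weights [w / m i] total 1, so the sum of the [sg i] stays below [g] even
   where the sets [W i] overlap. *)
pose w := (\sum_(i < k.+1) (m i)^-1)^-1.
have w0 : 0 < w.
  rewrite invr_gt0 big_ord_recr /=; apply: ltr_wpDl; last by rewrite invr_gt0.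
  by apply: sumr_ge0 => i _; rewrite invr_ge0 ltW.
have wm0 i : 0 <= w / m i by rewrite divr_ge0 ?ltW.
have /choice[sg hsg] i := exists_restr_scaled g (mW i) (wm0 i).
have /choice[pg hpg] i := exists_pushforward (sg i) (@measurable_fst_borel X Y).
have mi0 i : 0 <= (m i)^-1 by rewrite invr_ge0 ltW.
have /choice[ng hng] i := exists_restr_scaled g (mW i) (mi0 i).
have /choice[qg' hqg'] i := exists_pushforward (ng i) (@measurable_snd_borel X Y).
have q1 i : qg' i setT = 1%E.
  by rewrite hqg' preimage_setT hng setTI [X in (_ * X)%E]mE -EFinM mulVf// gt_eqF.
have /choice[qg hqg] i := exists_probability (q1 i).
(* First marginal of [sg (s i)], of mass [w], times the normalised second marginal of [sg i]:
   without the normalisation the product would have mass [w ^ 2]. *)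
have /choice[tg htg] i := exists_coupling (pg (s i)) (qg i) b1 b2.
have sgT i : sg i setT = w%:E.
  by rewrite hsg setTI [X in (_ * X)%E]mE -EFinM divfK// gt_eqF.
have tgT i : tg i setT = w%:E.
  rewrite -setXTT htg// hpg preimage_setT sgT.
  by rewrite [X in (_ * X)%E]probability_setT mule1.
have sgW i : sg i (~` W i) = 0%E by rewrite hsg setICl measure0 mule0.
pose W' i := U (s i) `*` V i.
have mW' i : measurable (W' i : set XY) by exact: measurable_setX_borel.
have pgU i : pg i (~` U i) = 0%E.
  have UW0 : fst @^-1` (~` U i) `&` W i = set0.
    by apply/seteqP; split => // -[x y] [/= nU [Ux _]].
  by rewrite hpg hsg UW0 measure0 mule0.
have qgV i : qg i (~` V i) = 0%E.
  have VW0 : snd @^-1` (~` V i) `&` W i = set0.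
    by apply/seteqP; split => // -[x y] [/= nV [_ Vy]].
  by rewrite hqg hqg' hng VW0 measure0 mule0.
have tgW i : tg i (~` W' i) = 0%E.
  apply/eqP; rewrite -measure_le0.
  have sub : ~` W' i `<=` (~` U (s i)) `*` setT `|` setT `*` (~` V i).
    by move=> [x y] /= /not_andP[h|h]; [left|right].
  have mU' : measurable (~` U (s i) : set (borel X)) by exact: measurableC.
  have mV' : measurable (~` V i : set (borel Y)) by exact: measurableC.
  apply: le_trans (le_measure (tg i) _ _ sub) _; rewrite ?inE.
  - exact: measurableC.
  - by apply: measurableU; exact: measurable_setX_borel.
  apply: le_trans (measureU2 (tg i) _ _) _; try exact: measurable_setX_borel.
  have t1 : tg i ((~` U (s i)) `*` setT) = 0%E by rewrite htg// pgU mul0e.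
  have t2 : tg i (setT `*` (~` V i)) = 0%E by rewrite htg// [X in (_ * X)%E]qgV mule0.
  by rewrite [X in (X + _)%E]t1 [X in (_ + X)%E]t2 adde0.
have mc : measurable_fun [set: XY] c.
  by apply/measurable_EFinP; exact: continuous_measurable_EFin.
have cW i v : W i v -> c (z i) - e <= c v <= c (z i) + e.
  case: v => x y [/= [Ux _] [Vy _]]; have [_ _ _ _ /(_ x y Ux Vy)] := hN i.
  by rewrite ler_distl.
have cW' i v : W' i v -> c ((z i.+1).1, (z i).2) - e <= c v <= c ((z i.+1).1, (z i).2) + e.
  case: v => x y [/= [_ Ux] [_ Vy]]; rewrite ps in Ux.
  have [_ _ _ _ /(_ x y Ux Vy)] := hN' i.
  by rewrite ler_distl.
have isg i := integrable_concentrated (mW i) (sgW i) (sgT i) mc (@cW i).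
have itg i := integrable_concentrated (mW' i) (tgW i) (tgT i) mc (@cW' i).
have [_ is_] := integral_msum k.+1 isg.
have [it it_] := integral_msum k.+1 itg.
have ex := @optimal_plan_exchange R X Y rho mu c a b cc ia ib cab g og
  (msum sg k.+1) (msum tg k.+1).
have shift (f : nat -> \bar R) : (\sum_(i < k.+1) f (s i) = \sum_(i < k.+1) f i)%E.
  rewrite big_ord_recr big_ord_recl /= addeC /s eqxx; congr (_ + _)%E.
  by apply: eq_bigr => i _ /=; rewrite ltn_eqF.
have {ex} : (\int[msum sg k.+1]_z (c z)%:E <= \int[msum tg k.+1]_z (c z)%:E)%E.
  apply: ex => //.
  - move=> E mE'; rewrite /= /msum.
    have gE : g E \is a fin_num by exact: fin_num_measure.
    apply: (@le_trans _ _ (\sum_(i < k.+1) ((w / m i) * fine (g E))%:E)%E).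
      apply: lee_sum => i _; rewrite hsg [leRHS]EFinM fineK//.
      apply: lee_pmul => //; first by rewrite lee_fin.
      by apply: le_measure; rewrite ?inE//; exact: measurableI.
    rewrite sumEFin -mulr_suml -mulr_sumr mulVf ?mul1r ?fineK//.
    by rewrite -invr_eq0 gt_eqF.
  - move=> A mA; rewrite /= /msum -(shift (fun i => sg i (A `*` setT))).
    apply: eq_bigr => i _; rewrite htg// [X in (_ * X)%E]probability_setT mule1 hpg.
    by rewrite setXT.
  - move=> B mB; rewrite /= /msum; apply: eq_bigr => i _.
    have qB : qg i B = ((m i)^-1%:E * g (snd @^-1` B `&` W i))%E.
      by rewrite hqg hqg' hng.
    rewrite htg// hpg preimage_setT sgT [X in (_ * X)%E]qB hsg setTX EFinM.
    by rewrite muleA.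
rewrite is_ it_ => ex.
have {ex} : ((\sum_(i < k.+1) (c (z i) - e) * w)%:E <=
    (\sum_(i < k.+1) (c ((z i.+1).1, (z i).2) + e) * w)%:E)%E.
  rewrite -!sumEFin; apply: (le_trans _ (le_trans ex _)); apply: lee_sum => i _.
    by have /andP[] := integral_concentrated (mW i) (sgW i) (sgT i) mc (@cW i).
  by have /andP[] := integral_concentrated (mW' i) (tgW i) (tgT i) mc (@cW' i).
rewrite lee_fin -!mulr_suml ler_pM2r// big_split [in X in _ <= X -> _]big_split /=.
rewrite sumrN !sumr_const card_ord.
have -> : \sum_(i < k.+1) c ((z i.+1).1, (z i).2) = S + \sum_(i < k.+1) c (z i).
  rewrite /S big_mkord -big_split /=; apply: eq_bigr => i _; by rewrite subrK.
have eS : e *+ k.+1 = - S / 4.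
  have K0 : k.+1%:R != 0 :> R by rewrite pnatr_eq0.
  rewrite -[LHS]mulr_natr /e; move: K0; set K := k.+1%:R => K0.
  by rewrite -[K *+ 4]mulr_natr; field.
rewrite eS => h.
have arith (A B : R) : B < 0 -> A - - B / 4 <= B + A + - B / 4 -> False by lra.
exact: arith S0 h.
Qed.

End CyclicalMonotonicity.

(** * Duality *)

Section Conjugate.
Context (R : realType) (S T : ptopologicalType) (k : S -> T -> R).
Hypothesis ck : forall x, continuous (k x).
Local Open Scope ereal_scope.

(** The c-transform, with the infimum over [P] so that it also applies to a potential controlled on
    a projection only. A point where [f] is [-oo] contributes [+oo] and imposes nothing. *)
Definition conjugate (P : set S) (f : S -> \bar R) (y : T) : \bar R :=
  ereal_inf [set (k x y)%:E - f x | x in P].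

Lemma conjugate_le (P : set S) (f : S -> \bar R) x y : P x ->
  conjugate P f y <= (k x y)%:E - f x.
Proof. by move=> Px; apply: ereal_inf_lbound; exists x. Qed.

Lemma le_conjugate (P : set S) (f : S -> \bar R) y (v : \bar R) :
  (forall x, P x -> v <= (k x y)%:E - f x) -> v <= conjugate P f y.
Proof. by move=> h; apply: le_ereal_inf_tmp => _ [x Px <-]; exact: h. Qed.

Lemma open_conjugate_lt (P : set S) (f : S -> \bar R) (t : R) :
  open [set y | conjugate P f y < t%:E].
Proof.
have -> : [set y | conjugate P f y < t%:E] =
    \bigcup_(x in P) [set y | (k x y)%:E - f x < t%:E].
  apply/seteqP; split=> y /=.
    by move/ereal_inf_lt => [_ [x Px <-] h]; exists x.
  by move=> [x Px h]; apply: le_lt_trans h; exact: conjugate_le.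
apply: bigcup_open => x Px; case: (f x) => [r| |].
- rewrite (_ : mkset _ = k x @^-1` [set u | (u < t + r)%R]).
    by apply: open_comp; [move=> y _; exact: ck|exact: open_lt].
  by apply/seteqP; split=> y /=; rewrite -EFinB lte_fin ltrBlDr.
- rewrite (_ : mkset _ = setT); first exact: openT.
  by apply/seteqP; split=> y //= _; rewrite ltNyr.
- rewrite (_ : mkset _ = set0); first exact: open0.
  by apply/seteqP; split=> y //=.
Qed.

Lemma measurable_conjugate (P : set S) (f : S -> \bar R) :
  measurable_fun [set: borel T] (conjugate P f).
Proof. by apply: measurable_usc => t; exact: open_conjugate_lt. Qed.

Lemma conjugate_feasible (P : set S) (f : S -> \bar R) x y : P x -> f x != +oo ->
  f x + conjugate P f y <= (k x y)%:E.
Proof.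
move=> Px; have := @conjugate_le P f x y Px; case: (f x) => [r h _|//|_ _]; last by rewrite addNye leNye.
by move: h; rewrite leeBrDl.
Qed.

Lemma le_conjugate_of_feasible (P : set S) (f : S -> \bar R) (h : T -> \bar R) y :
  (forall x, P x -> f x != +oo) -> (forall x, P x -> f x + h y <= (k x y)%:E) ->
  h y <= conjugate P f y.
Proof.
move=> fy fh; apply: le_conjugate => x Px; have := fh x Px; have := fy x Px.
case: (f x) => [r _ e|//|_ _]; last by rewrite /= leey.
by rewrite leeBrDl.
Qed.

End Conjugate.

Section AeEqOfLe.
Context (d : measure_display) (T : measurableType d) (R : realType)
  (m : {measure set T -> \bar R}).
Local Open Scope ereal_scope.

Lemma ae_eq_of_le_integral (f h : T -> \bar R) :
  m.-integrable setT f -> m.-integrable setT h -> (forall x, f x <= h x) ->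
  \int[m]_x h x <= \int[m]_x f x -> ae_eq m setT f h.
Proof.
move=> iF ih fh hf.
have mf := measurable_int _ iF; have mh := measurable_int _ ih.
have ff := integrable_ae measurableT iF; have hfin := integrable_ae measurableT ih.
have ihf : m.-integrable setT (h \- f) by exact: integrableB.
have mhf := measurable_int _ ihf.
have : \int[m]_x `|(h \- f) x| = 0.
  transitivity (\int[m]_x (h \- f) x).
    apply: ae_eq_integral => //; first exact: measurableT_comp.
    apply: filterS2 ff hfin => x /(_ I) fx /(_ I) hx _ /=.
    by rewrite gee0_abs// sube_ge0// ?fx// fh.
  rewrite integralB//.
  apply/eqP; rewrite eq_le; apply/andP; split.
    by rewrite sube_le0.
  rewrite sube_ge0; last by rewrite (integrable_fin_num measurableT iF).
  by apply: le_integral => // x _; exact: fh.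
move/(ae_eq_integral_abs _ measurableT mhf) => e.
apply: filterS3 ff hfin e => x /(_ I) fx /(_ I) hx /(_ I) /= /eqP e _.
by move: e; rewrite sube_eq// add0e => /eqP.
Qed.

End AeEqOfLe.

Section Duality.
Context (R : realType) (X Y : ptopologicalType).
Variables (rho : probability (borel X) R) (mu : probability (borel Y) R).
Variables (c : X * Y -> R) (a : X -> R) (b : Y -> R).
Hypotheses (cc : continuous c) (ia : rho.-integrable setT (EFin \o a))
  (ib : mu.-integrable setT (EFin \o b))
  (cab : forall x y, `|c (x, y)| <= a x + b y).
Let XY := borel (X * Y)%type.
Local Open Scope ereal_scope.

Definition conjX (h : Y -> \bar R) : X -> \bar R :=
  conjugate (fun y x => c (x, y)) setT h.

Definition conjY (P : set X) (f : X -> \bar R) : Y -> \bar R :=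
  conjugate (fun x y => c (x, y)) P f.

Let cX y : continuous (fun x => c (x, y)).
Proof.
move=> x; apply: (@continuous_comp _ _ _ (fun x => (x, y)) c); last exact: cc.
by apply: cvg_pair; [exact: cvg_id|exact: cvg_cst].
Qed.

Let cY x : continuous (fun y => c (x, y)).
Proof.
move=> y; apply: (@continuous_comp _ _ _ (fun y => (x, y)) c); last exact: cc.
by apply: cvg_pair; [exact: cvg_cst|exact: cvg_id].
Qed.

Lemma measurable_conjX h : measurable_fun [set: borel X] (conjX h).
Proof. exact: measurable_conjugate. Qed.

Lemma measurable_conjY P f : measurable_fun [set: borel Y] (conjY P f).
Proof. exact: measurable_conjugate. Qed.

Lemma open_conjX_lt h (t : R) : open [set x | conjX h x < t%:E].
Proof. exact: open_conjugate_lt. Qed.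

Lemma open_conjY_lt P f (t : R) : open [set y | conjY P f y < t%:E].
Proof. exact: open_conjugate_lt. Qed.

Lemma weak_duality (g : probability XY R) f h : coupling rho mu g ->
  dual_feasible rho mu c f h -> dual_value rho mu f h <= cost c g.
Proof.
move=> cg [[iF _] [ih _] fh]; rewrite /dual_value -(coupling_integralD cg iF ih).
apply: le_integral => //.
- exact: (coupling_integrableD cg iF ih).
- exact: (cost_integrable cc ia ib cab cg).
- by move=> [x y] _; exact: fh.
Qed.

Lemma negligible_not_full (g : probability XY R) (S : set (X * Y)) :
  g.-negligible (~` S) -> exists z, S z.
Proof.
move=> [N [mN gN SN]]; apply: contrapT => nS.
have NT : N = setT by apply/seteqP; split=> // z _; apply: SN => /= Sz; apply: nS; exists z.
by move: gN; rewrite NT probability_setT => /eqP; rewrite onee_eq0.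
Qed.

Section PotentialPair.
Variables (g : probability XY R) (S : set (X * Y)) (phi : X -> R).
Hypotheses (cg : coupling rho mu g) (gS : g.-negligible (~` S)).
Hypothesis phiS : forall x y x', S (x, y) -> (fst @` S) x' ->
  (phi x' - phi x <= c (x', y) - c (x, y))%R.

(** [phi] is controlled on the projection of [S] only, and comes with no measurability. Conjugates
    are upper semicontinuous whatever they start from, so [F] is a measurable extension of [phi] to
    the whole space. *)
Let H := conjY (fst @` S) (EFin \o phi).
Let F := conjX H.

Let HS x y : S (x, y) -> H y = (c (x, y) - phi x)%:E.
Proof.
move=> Sxy; apply/eqP; rewrite eq_le; apply/andP; split.
  have := @conjugate_le _ _ _ (fun x y => c (x, y)) (fst @` S) (EFin \o phi) x y.
  by rewrite /= -EFinB; apply; exists (x, y).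
apply: le_conjugate => x' Sx'; rewrite /= -EFinB lee_fin.
by have := phiS Sxy Sx'; lra.
Qed.

Let HleS x y : (fst @` S) x -> H y <= (c (x, y) - phi x)%:E.
Proof. by move=> Sx; have := @conjugate_le _ _ _ (fun x y => c (x, y)) _ (EFin \o phi) x y Sx. Qed.

Let Hny y : H y != +oo.
Proof.
have [[x0 y0] S0] := negligible_not_full gS.
rewrite -ltey; apply: le_lt_trans (@HleS x0 y _) _; first by exists (x0, y0).
by rewrite ltry.
Qed.

Let Fle x y r : H y = r%:E -> F x <= (c (x, y) - r)%:E.
Proof.
move=> Hy; have := @conjugate_le _ _ _ (fun y x => c (x, y)) setT H y x I.
by rewrite Hy -EFinB.
Qed.

Let Fny x : F x != +oo.
Proof.
have [[x0 y0] S0] := negligible_not_full gS.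
by rewrite -ltey; apply: le_lt_trans (Fle x (HS S0)) _; rewrite ltry.
Qed.

Let FS x : (fst @` S) x -> F x = (phi x)%:E.
Proof.
move=> Sx; apply/eqP; rewrite eq_le; apply/andP; split.
  have [[x1 y] Sxy /= e] := Sx; rewrite -e.
  apply: le_trans (Fle x1 (HS Sxy)) _; rewrite lee_fin; lra.
apply: le_conjugate => y _; have := HleS y Sx; have := Hny y.
case: (H y) => [r| |] // _; last by rewrite /= leey.
by rewrite -EFinB !lee_fin => h; lra.
Qed.

Let FHS x y : S (x, y) -> F x + H y = (c (x, y))%:E.
Proof.
move=> Sxy; rewrite FS; last by exists (x, y).
by rewrite (HS Sxy) -EFinD; congr EFin; lra.
Qed.

Let FHle x y : F x + H y <= (c (x, y))%:E.
Proof. by rewrite addeC; apply: conjugate_feasible. Qed.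

Let integrable_on_S (f : X * Y -> \bar R) (u : X * Y -> \bar R) :
  measurable_fun [set: XY] f -> g.-integrable setT u ->
  (forall z, S z -> `|f z| <= `|u z|) -> g.-integrable setT f.
Proof.
move=> mf iu fu; have [N [mN gN SN]] := gS.
have mTN : measurable (setT `\` N : set XY) by exact: measurableD.
apply/(negligible_integrable mN measurableT mf gN).
have iuN : g.-integrable (setT `\` N) u by exact: integrableS iu.
apply: le_integrable iuN => //; first exact: measurable_funS mf.
by move=> z [_ Nz]; apply: fu; apply: contrapT => nS; apply: Nz; exact: SN.
Qed.

Let bound (C : R) : g.-integrable setT
  (fun z => ((`|a z.1| + `|b z.2|) + (`|a z.1| + `|b z.2|) + C)%R%:E).
Proof.
have i1 := coupling_integrableD cg (integrable_norm ia) (integrable_norm ib).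
have i2 := integrableD measurableT i1 i1.
have i3 : g.-integrable setT (fun=> C%:E) by exact: finite_measure_integrable_cst.
exact: (integrableD measurableT i2 i3).
Qed.

(** The terms at a fixed [(x0, y0)] in [S] bound both conjugates from above: [F x <= a x + C1] and
    [H y <= b y + C2]. Since [F + H = c] on [S], an upper bound for one is a lower bound for the
    other. *)
Let bounds : exists C, forall x y, S (x, y) ->
  `|F x| <= ((`|a x| + `|b y|) + (`|a x| + `|b y|) + C)%:E /\
  `|H y| <= ((`|a x| + `|b y|) + (`|a x| + `|b y|) + C)%:E.
Proof.
have [[x0 y0] S0] := negligible_not_full gS.
pose C1 := (b y0 - (c (x0, y0) - phi x0))%R; pose C2 := (a x0 - phi x0)%R.
exists (`|C1| + `|C2|)%R => x y Sxy.
have Sx : (fst @` S) x by exists (x, y).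
have hF := Fle x (HS S0); have hH : H y <= (c (x0, y) - phi x0)%:E.
  by apply: HleS; exists (x0, y0).
move: hF hH; rewrite FS// (HS Sxy) !lee_fin => hF hH.
have := cab x y; have := cab x y0; have := cab x0 y.
rewrite !ler_norml => /andP[_ h1] /andP[_ h2] /andP[h3 h4].
have k1 : (b y0 - (c (x0, y0) - phi x0) <= `|C1|)%R by exact: ler_norm.
have k2 : (a x0 - phi x0 <= `|C2|)%R by exact: ler_norm.
have k3 := ler_norm (a x); have k4 := ler_norm (b y).
have n1 := normr_ge0 C1; have n2 := normr_ge0 C2.
have n3 := normr_ge0 (a x); have n4 := normr_ge0 (b y).
move: k1 k2 k3 k4 n1 n2 n3 n4.
move: (`|C1|)%R (`|C2|)%R (`|a x|)%R (`|b y|)%R => u1 u2 u3 u4 *.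
by split; apply/andP; split; lra.
Qed.

Let mF : measurable_fun [set: borel X] F. Proof. exact: measurable_conjX. Qed.
Let mH : measurable_fun [set: borel Y] H. Proof. exact: measurable_conjY. Qed.

Let intF : rho.-integrable setT F.
Proof.
have [C hC] := bounds; apply: (coupling_integrable_fst cg mF).1.
have m1 : measurable_fun [set: XY] (F \o fst).
  exact: (measurableT_comp mF (@measurable_fst_borel X Y)).
apply: (integrable_on_S m1 (bound C)).
move=> [x y] Sxy; apply: le_trans (hC x y Sxy).1 _.
by rewrite lee_fin ler_norm.
Qed.

Let intH : mu.-integrable setT H.
Proof.
have [C hC] := bounds; apply: (coupling_integrable_snd cg mH).1.
have m1 : measurable_fun [set: XY] (H \o snd).
  exact: (measurableT_comp mH (@measurable_snd_borel X Y)).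
apply: (integrable_on_S m1 (bound C)).
move=> [x y] Sxy; apply: le_trans (hC x y Sxy).2 _.
by rewrite lee_fin ler_norm.
Qed.

(** Equality [F + H = c] on the set [S] that carries [g] gives the pair the value [cost c g], which
    weak duality makes an upper bound for every feasible pair. *)
Lemma potential_pair : exists f h, [/\ dual_optimal rho mu c f h,
  dual_value rho mu f h = cost c g &
  forall x, (fst @` S) x -> f x = (phi x)%:E].
Proof.
have val : dual_value rho mu F H = cost c g.
  rewrite /dual_value -(coupling_integralD cg intF intH).
  apply: ae_eq_integral => //.
  - exact: (measurable_int _ (coupling_integrableD cg intF intH)).
  - exact: continuous_measurable_EFin.
  - apply: negligibleS gS => -[x y] /= nxy Sxy; apply: nxy => _.
    exact: FHS.
exists F, H; split => //; split; first by split.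
by move=> f' h' fh'; rewrite val; exact: (weak_duality cg fh').
Qed.

End PotentialPair.
End Duality.

(** * Potentials of cyclically monotone sets *)

Section Rockafellar.
Context (R : realType) (X Y : ptopologicalType).
Variables (c : X * Y -> R) (S : set (X * Y)).
Hypothesis S_cyclic : forall k (z : nat -> X * Y), (forall i, S (z i)) ->
  z k.+1 = z 0%N ->
  0 <= \sum_(0 <= i < k.+1) (c ((z i.+1).1, (z i).2) - c (z i)).

(** Overwrites position [n] by [p] and puts [q] after it. Since [chain_sum] does not see the second
    coordinate of the last point, [p] may be any point with the same first coordinate as [z n]. *)
Definition extend_chain (n : nat) (z : nat -> X * Y) (p q : X * Y) (i : nat) :=
  if (i < n)%N then z i else if i == n then p else q.

Lemma chain_sum_extend n z p q : p.1 = (z n).1 ->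
  chain_sum c n.+1 (extend_chain n z p q) =
  chain_sum c n z + (c (q.1, p.2) - c p).
Proof.
move=> pz; rewrite /chain_sum big_nat_recr//=; congr (_ + _).
  apply: eq_big_nat => i /andP[_ i_n]; rewrite /extend_chain i_n.
  have [//|n_i] := ltnP i.+1 n.
  have <- : n = i.+1 by apply/eqP; rewrite eqn_leq n_i i_n.
  by rewrite eqxx pz.
by rewrite /extend_chain ltnn eqxx ltnNge leqnSn /= gtn_eqF// -surjective_pairing.
Qed.

Lemma extend_chain_in n z p q : (forall i, S (z i)) -> S p -> S q ->
  forall i, S (extend_chain n z p q i).
Proof. by move=> Sz Sp Sq i; rewrite /extend_chain; case: ifP => // _; case: ifP. Qed.

Variables (w0 : X * Y) (Sw0 : S w0).

Definition chain_values (x : X) : set R :=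
  [set r | exists n z, [/\ forall i, S (z i), (z 0%N).1 = w0.1, (z n).1 = x &
    r = chain_sum c n z]].

Definition rockafellar_potential (x : X) : R := inf (chain_values x).

Let values_ne x : (fst @` S) x -> chain_values x !=set0.
Proof.
move=> [p Sp <-]; exists (chain_sum c 1 (fun i => if i is 0 then w0 else p)).
by exists 1%N, (fun i => if i is 0 then w0 else p); split => // -[].
Qed.

(** A chain from [w0.1] to [p.1] is closed up by the step from [p] back to [w0.1]; cyclical
    monotonicity makes the closed sum nonnegative. The bound does not depend on the chain. *)
Let values_lb p r : S p -> chain_values p.1 r -> c p - c (w0.1, p.2) <= r.
Proof.
move=> Sp [n [z [Sz z0 zn ->]]].
(* The cycle must return to its own first point. For [n = 0] position 0 has been overwritten by [p],
   so this point is [p] rather than [z 0]. *)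
pose q := if n is 0 then p else z 0%N.
have Sq : S q by rewrite /q; case: (n).
have q1 : q.1 = w0.1.
  by rewrite /q; move: zn; case: (n) => [|k] // zk; rewrite -zk z0.
have := @S_cyclic n (extend_chain n z p q) (extend_chain_in n Sz Sp Sq).
have -> : extend_chain n z p q n.+1 = extend_chain n z p q 0.
  rewrite /extend_chain ltnNge leqnSn /= gtn_eqF// /q.
  by case: (n).
move=> /(_ erefl); have := @chain_sum_extend n z p q (esym zn).
rewrite /chain_sum q1 => e h.
suff : 0 <= \sum_(0 <= i < n) (c ((z i.+1).1, (z i).2) - c ((z i).1, (z i).2)) +
    (c (w0.1, p.2) - c p) by lra.
rewrite -e; apply: le_trans h _; rewrite le_eqVlt; apply/orP; left; apply/eqP.
by apply: eq_bigr => i _; rewrite -surjective_pairing.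
Qed.

Let values_inf x : (fst @` S) x -> has_inf (chain_values x).
Proof.
move=> Sx; split; first exact: values_ne.
have [p Sp e] := Sx; exists (c p - c (w0.1, p.2)) => r; rewrite -e; exact: values_lb.
Qed.

(** Every chain that ends at [x] can be continued through [(x, y)] to [x'], at the additional cost
    [c (x', y) - c (x, y)]. *)
Lemma rockafellar_potentialP x y x' : S (x, y) -> (fst @` S) x' ->
  rockafellar_potential x' - rockafellar_potential x <= c (x', y) - c (x, y).
Proof.
move=> Sxy Sx'.
have Sx : (fst @` S) x by exists (x, y).
suff : rockafellar_potential x' - (c (x', y) - c (x, y)) <= rockafellar_potential x by lra.
apply: lb_le_inf; first exact: values_ne.
move=> _ [n [z [Sz z0 zn ->]]].
have [p Sp e] := Sx'.
have : rockafellar_potential x' <= chain_sum c n.+1 (extend_chain n z (x, y) p).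
  apply: ge_inf; first by case: (values_inf Sx').
  exists n.+1, (extend_chain n z (x, y) p); split => //.
  - exact: extend_chain_in.
  - by rewrite /extend_chain; case: n zn => [|n] //= zn; rewrite -zn z0.
  - by rewrite /extend_chain ltnNge leqnSn /= gtn_eqF.
by rewrite chain_sum_extend//= e; lra.
Qed.

End Rockafellar.

Section StrongDuality.
Context (R : realType) (X Y : ptopologicalType).
Variables (rho : probability (borel X) R) (mu : probability (borel Y) R).
Variables (B1 : nat -> set X) (B2 : nat -> set Y).
Hypotheses (b1 : open_base B1) (b2 : open_base B2).
Variables (c : X * Y -> R) (a : X -> R) (b : Y -> R).
Hypotheses (cc : continuous c) (ia : rho.-integrable setT (EFin \o a))
  (ib : mu.-integrable setT (EFin \o b))
  (cab : forall x y, `|c (x, y)| <= a x + b y).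
Let XY := borel (X * Y)%type.
Local Open Scope ereal_scope.

Let spt_negligible (g : probability XY R) :
  g.-negligible (~` spt (T := (X * Y)%type) g).
Proof. by have [B [_ _ bB]] := open_base_prod b1 b2; exact: (@spt_null R (X * Y)%type _ g bB). Qed.

Lemma strong_duality (g : probability XY R) f h : optimal_plan rho mu c g ->
  dual_optimal rho mu c f h -> dual_value rho mu f h = cost c g.
Proof.
move=> og [ff opt]; have [cg _] := og.
have cyc := @spt_cyclically_monotone R X Y rho mu B1 B2 b1 b2 c a b cc ia ib cab g og.
have [w Sw] := negligible_not_full (spt_negligible g).
have pot := @rockafellar_potentialP R X Y c _ cyc w Sw.
have [f' [h' [[ff' _] val _]]] :=
  @potential_pair R X Y rho mu c a b cc ia ib cab g _ _ cg (spt_negligible g) pot.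
apply/eqP; rewrite eq_le; apply/andP; split.
  exact: (weak_duality cc ia ib cab cg ff).
by rewrite -val; exact: opt.
Qed.

(** At a step of the chain, feasibility gives [f x_(i+1) <= c (x_(i+1), y_i) - h y_i] and contact
    gives [f x_i = c (x_i, y_i) - h y_i]; subtracting removes [h], and the differences telescope. *)
Lemma spt_opt_lambda_bound (f : X -> \bar R) (h : Y -> \bar R) :
  (forall x, f x != +oo) -> (forall y, h y != +oo) ->
  (forall x y, f x + h y <= (c (x, y))%:E) ->
  (forall z, spt_opt rho mu c z -> f z.1 + h z.2 = (c z)%:E) ->
  (forall x, proj_opt rho mu c x -> f x \is a fin_num) /\
  forall x x', proj_opt rho mu c x -> proj_opt rho mu c x' ->
    f x - f x' <= lambda rho mu c x x'.
Proof.
move=> fy hy fh eq.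
have ffin z : spt_opt rho mu c z -> f z.1 \is a fin_num /\ h z.2 \is a fin_num.
  move=> /eq; have := fy z.1; have := hy z.2.
  by case: (f z.1) => [r| |]; case: (h z.2) => [s| |].
have pfin x : proj_opt rho mu c x -> f x \is a fin_num by move=> [z /ffin[+ _] <-].
split => // x x' px px'; apply: le_ereal_inf_tmp => _ [n [z [[zn z0 zn1] ->]]].
rewrite -z0 -zn1 => {z0 zn1}.
have key m : (m <= n)%N -> f (z m).1 - f (z 0%N).1 <= (chain_sum c m z)%:E.
  elim: m => [|m IH] mn.
    by rewrite /chain_sum big_geq// subee//; exact: (ffin _ (zn _ mn)).1.
  have := IH (ltnW mn); have [] := ffin _ (zn _ (ltnW mn)).
  have [+ _] := ffin _ (zn _ mn); have [+ _] := ffin _ (zn _ (leq0n n)).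
  have := eq _ (zn _ (ltnW mn)); have := fh (z m.+1).1 (z m).2.
  rewrite /chain_sum big_nat_recr//=.
  case: (f (z m.+1).1) => [r1| |] //; case: (f (z 0%N).1) => [r0| |] //.
  case: (f (z m).1) => [r| |] //; case: (h (z m).2) => [s| |] //.
  move=> + + _ _ _ _; rewrite -surjective_pairing -!EFinD !lee_fin => h1 [h2] h3.
  lra.
exact: key.
Qed.

End StrongDuality.

(** * The two inclusions *)

Lemma L1_sandwich (d : measure_display) (T : measurableType d) (R : realType)
    (m : probability T R) (f F : T -> \bar R) (u : T -> R) (C : R) :
  L1 m f -> m.-integrable setT (EFin \o u) -> measurable_fun setT F ->
  (forall x, (f x <= F x)%E) -> (forall x, (F x <= (u x + C)%:E)%E) -> L1 m F.
Proof.
move=> [iF _] iu mF fF Fu; split; last first.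
  by move=> x; rewrite -ltey; apply: le_lt_trans (Fu x) _; rewrite ltry.
have iC : m.-integrable setT (fun=> C%:E) by exact: finite_measure_integrable_cst.
have i1 := integrableD measurableT iu iC.
have i2 := integrableD measurableT (integrable_abse iF) (integrable_abse i1).
apply: (le_integrable _ _ _ i2) => // x _ /=; have := fF x; have := Fu x.
case: (F x) => [r| |] //.
- case: (f x) => [s| |] // ur sr; last by rewrite /= leey.
  rewrite /= lee_fin in ur; rewrite lee_fin in sr.
  rewrite lee_fin [leRHS]ger0_norm ?addr_ge0//.
  have := ler_norm (u x + C); have := ler_norm (- s); rewrite normrN.
  have := normr_ge0 s; have := normr_ge0 (u x + C).
  by rewrite ler_norml => *; apply/andP; split; lra.
- by case: (f x).
Qed.

Lemma L1_fin_point (d : measure_display) (T : measurableType d) (R : realType)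
    (m : probability T R) (f : T -> \bar R) :
  L1 m f -> exists x, f x \is a fin_num.
Proof.
move=> [iF _]; apply: contrapT => nf.
have [N [mN N0 sub]] := integrable_ae measurableT iF.
have NT : N = setT.
  by apply/seteqP; split=> // x _; apply: sub => /= /(_ I) fx; apply: nf; exists x.
have m1 := probability_setT m; rewrite -NT in m1.
by have /eqP := etrans (esym m1) N0; rewrite onee_eq0.
Qed.

Section Inclusions.
Context (R : realType) (X Y : ptopologicalType).
Variables (rho : probability (borel X) R) (mu : probability (borel Y) R).
Variables (B1 : nat -> set X) (B2 : nat -> set Y).
Hypotheses (b1 : open_base B1) (b2 : open_base B2).
Hypotheses (rho_reg : regular rho) (mu_reg : regular mu).
Variables (c : X * Y -> R) (a : X -> R) (b : Y -> R).
Hypotheses (cc : continuous c) (ia : rho.-integrable setT (EFin \o a))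
  (ib : mu.-integrable setT (EFin \o b))
  (cab : forall x y, `|c (x, y)| <= a x + b y).
Let XY := borel (X * Y)%type.
Local Open Scope ereal_scope.

Definition lambda_potentials : set (X -> \bar R) :=
  [set phi | [/\ L1 rho phi,
     forall x, proj_opt rho mu c x -> phi x \is a fin_num &
     forall x x', proj_opt rho mu c x -> proj_opt rho mu c x' ->
       phi x - phi x' <= lambda rho mu c x x']].

(** Integrability of the conjugate comes from two sides: it is at least [f], and at most its term at
    a point [y0] where [h] is finite. *)
Lemma feasible_conjX f h : dual_feasible rho mu c f h ->
  (forall x, f x <= conjX c h x) /\ dual_feasible rho mu c (conjX c h) h.
Proof.
move=> [L1f L1h fh].
have le x : f x <= conjX c h x.
  apply: (@le_conjugate_of_feasible _ _ _ (fun y x => c (x, y))) => y _.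
    exact: L1h.2.
  by rewrite addeC; exact: fh.
split=> //; split => //; last first.
  by move=> x y; rewrite addeC; apply: conjugate_feasible => //; exact: L1h.2.
have [y0 hy0] := L1_fin_point L1h.
have mF : measurable_fun [set: borel X] (conjX c h) by exact: measurable_conjX.
apply: (@L1_sandwich _ (borel X) R rho f (conjX c h) a (b y0 - fine (h y0))%R L1f ia mF le).
move=> x; have := @conjugate_le _ _ _ (fun y x => c (x, y)) setT h y0 x I.
move=> /le_trans; apply; rewrite -{1}(fineK hy0) -EFinB lee_fin.
by have := cab x y0; rewrite ler_norml => /andP[_]; lra.
Qed.

Lemma feasible_conjY f h : dual_feasible rho mu c f h ->
  (forall y, h y <= conjY c setT f y) /\ dual_feasible rho mu c f (conjY c setT f).
Proof.
move=> [L1f L1h fh].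
have le y : h y <= conjY c setT f y.
  apply: (@le_conjugate_of_feasible _ _ _ (fun x y => c (x, y))) => x _ //.
  exact: L1f.2.
split=> //; split => //; last first.
  by move=> x y; apply: (@conjugate_feasible _ _ _ (fun x y => c (x, y))) => //; exact: L1f.2.
have [x0 fx0] := L1_fin_point L1f.
have mF : measurable_fun [set: borel Y] (conjY c setT f) by exact: measurable_conjY.
apply: (@L1_sandwich _ (borel Y) R mu h (conjY c setT f) b (a x0 - fine (f x0))%R L1h ib mF le).
move=> y; have := @conjugate_le _ _ _ (fun x y => c (x, y)) setT f x0 y I.
move=> /le_trans; apply; rewrite -{1}(fineK fx0) -EFinB lee_fin.
by have := cab x0 y; rewrite ler_norml => /andP[_]; lra.
Qed.

(* The contact set of two conjugates is closed, so it contains the support of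
   every plan it carries. *)
Lemma conjugates_eq_on_spt (g : probability XY R) (f' : X -> \bar R) (h' : Y -> \bar R) :
  optimal_plan rho mu c g ->
  (forall t, open [set x | f' x < t%:E]) -> (forall t, open [set y | h' y < t%:E]) ->
  dual_optimal rho mu c f' h' ->
  forall z, spt (T := (X * Y)%type) g z -> f' z.1 + h' z.2 = (c z)%:E.
Proof.
move=> og of_ oh [ff opt] z gz; have [cg _] := og.
have [[iF fy] [ih hy] fh] := ff.
apply/eqP; rewrite eq_le; apply/andP; split; first by case: z {gz} => x y; exact: fh.
rewrite leNgt; apply/negP => lt.
pose O := [set v : X * Y | f' v.1 + h' v.2 < (c v)%:E].
(* Two real bounds turn the strict inequality at [z] into conditions on [f'], [h'] and [c]
   separately, each of them open; this also covers the value [-oo]. *)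
have [s [t [fs ht st]]] : exists s t : R,
    [/\ f' z.1 < s%:E, h' z.2 < t%:E & (s + t < c z)%R].
  move: lt (fy z.1) (hy z.2).
  case: (f' z.1) => [r| |] //; case: (h' z.2) => [q| |] //.
  - rewrite lte_fin => rq _ _; exists (r + (c z - (r + q)) / 3)%R, (q + (c z - (r + q)) / 3)%R.
    by rewrite !lte_fin; split; lra.
  - move=> _ _ _; exists (r + 1)%R, (c z - r - 2)%R.
    by rewrite lte_fin ltNyr; split => //; lra.
  - move=> _ _ _; exists (c z - q - 2)%R, (q + 1)%R.
    by rewrite lte_fin ltNyr; split => //; lra.
  - move=> _ _ _; exists (c z - 1)%R, 0%R; rewrite !ltNyr; split => //; lra.
pose V := ([set x | f' x < s%:E] `*` [set y | h' y < t%:E]) `&` [set v | (s + t < c v)%R].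
have oV : open V.
  apply: openI; first by apply: open_setX.
  apply: (open_comp (f := c) (D := [set r | (s + t < r)%R])); last exact: open_gt.
  by move=> v _; exact: cc.
have : 0 < g V by apply: (gz V oV); split.
apply/negP; rewrite -leNgt measure_le0; apply/eqP.
have i1 := coupling_integrableD cg iF ih.
have i2 := cost_integrable cc ia ib cab cg.
have e := strong_duality b1 b2 cc ia ib cab og (conj ff opt).
have [||N [mN N0 sub]] := ae_eq_of_le_integral i1 i2.
- by move=> [x y]; exact: fh.
- by rewrite (coupling_integralD cg iF ih) -/(dual_value rho mu f' h') e.
apply/eqP; rewrite -measure_le0 -N0; apply: le_measure; rewrite ?inE//.
  exact: (@open_borel (X * Y)%type).
move=> v [[/= v1 v2] v3]; apply: sub => /= /(_ I) ev.
have : f' v.1 + h' v.2 < (c v)%:E.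
  by apply: lt_trans (lteD v1 v2) _; rewrite -EFinD lte_fin.
by rewrite ev ltxx.
Qed.

(** Passing from [f] to its double conjugate [f'] cannot lower the dual value, and optimality
    forbids raising it. So [f <= f'] have equal integrals and agree almost everywhere. *)
Theorem Phi_sub_lambda_potentials f : Phi rho mu c f ->
  exists2 f', lambda_potentials f' & ae_eq rho setT f f'.
Proof.
move=> [L1f [h L1h [feas opt]]].
have [lef feas1] := feasible_conjX feas.
have [leh feas2] := feasible_conjY feas1.
set f' := conjX c h in lef feas1 leh feas2.
set h' := conjY c setT f' in leh feas2.
have [[if' f'y] [ih' h'y] f'h'] := feas2.
have le1 : dual_value rho mu f h <= dual_value rho mu f' h.
  by rewrite /dual_value leeD2r//; apply: le_integral => //; exact: L1f.1.
have le2 : dual_value rho mu f' h <= dual_value rho mu f' h'.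
  by rewrite /dual_value leeD2l//; apply: le_integral => //; exact: L1h.1.
have opt' : dual_optimal rho mu c f' h'.
  split=> // f1 h1 /opt /le_trans; apply; exact: (le_trans le1 le2).
exists f'; last first.
  apply: ae_eq_of_le_integral => //; first exact: L1f.1.
  have := opt _ _ feas1; rewrite /dual_value leeD2rE//.
  exact: (integrable_fin_num measurableT L1h.1).
have [|fin ineq] := @spt_opt_lambda_bound R X Y rho mu c f' h' f'y h'y f'h'.
  move=> z [g og gz]; apply: (conjugates_eq_on_spt og) => //.
  - by move=> t; exact: open_conjX_lt.
  - by move=> t; exact: open_conjY_lt.
by split => //; case: feas1.
Qed.

Theorem lambda_potentials_sub_Phi f : lambda_potentials f ->
  exists2 f', Phi rho mu c f' & ae_eq rho setT f f'.
Proof.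
move=> [L1f ffin ineq].
have [g og] := exists_optimal_plan b1 b2 rho_reg mu_reg cc ia ib cab.
have [cg _] := og.
pose S := spt (T := (X * Y)%type) g.
have gS : g.-negligible (~` S).
  by have [B [_ _ bB]] := open_base_prod b1 b2; exact: (@spt_null R (X * Y)%type _ g bB).
have Sopt z : S z -> spt_opt rho mu c z by move=> Sz; exists g.
have pot x y x' : S (x, y) -> (fst @` S) x' ->
    (fine (f x') - fine (f x) <= c (x', y) - c (x, y))%R.
  move=> Sxy [p Sp px'].
  have fx : f x \is a fin_num by apply: ffin; exists (x, y) => //; exact: Sopt.
  have fx' : f x' \is a fin_num by apply: ffin; exists p => //; exact: Sopt.
  rewrite -lee_fin EFinB !fineK//; apply: le_trans (ineq x' x _ _) _.
  - by exists p => //; exact: Sopt.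
  - by exists (x, y) => //; exact: Sopt.
  (* The chain of length one from [(x, y)] to [p] already gives the inequality required of a
     potential. *)
  apply: ereal_inf_lbound; exists 1%N, (fun i => if i is 0 then (x, y) else p).
  split; last by rewrite /chain_sum big_nat1 /= px'.
  by split => //= -[_|i _]; exact: Sopt.
have [f' [h' [opt' val ff']]] := potential_pair cc ia ib cab cg gS pot.
have [[[if' f'y] L1h' fh'] _] := opt'.
exists f'; first by split => //; exists h'.
(* The projection of [S] may fail to be Borel. The set where [f] and [f'] differ is Borel, and its
   preimage lies in the null complement of [S], so its mass can be read off from [g]. *)
have mD : measurable ([set x | f x != f' x] : set (borel X)).
  have := measurable_neqe measurableT (measurable_int _ L1f.1) (measurable_int _ if').
  by rewrite setTI.
exists [set x | f x != f' x]; split => //; last first.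
  by move=> x /= nx; apply/eqP => fx; apply: nx.
have [N [mN N0 sub]] := gS.
have [cg1 _] := cg; apply: etrans (esym (cg1 _ mD)) _.
apply/eqP; rewrite -measure_le0 -N0.
apply: le_measure; rewrite ?inE//.
  by rewrite -[X in measurable X]setTI; exact: (@measurable_fst_borel X Y).
move=> z /= /eqP fz; apply: sub => /= Sz; apply: fz.
have Sz1 : (fst @` S) z.1 by exists z.
by rewrite ff'// fineK//; apply: ffin; exists z => //; exact: Sopt.
Qed.

Theorem Phi_lambda_potentials :
  modulo_null rho (Phi rho mu c) = modulo_null rho lambda_potentials.
Proof.
apply/seteqP; split => f [L1f [g Pg fg]]; split => //.
- have [g' Pg' gg'] := Phi_sub_lambda_potentials Pg.
  by exists g' => //; exact: ae_eq_trans fg gg'.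
- have [g' Pg' gg'] := lambda_potentials_sub_Phi Pg.
  by exists g' => //; exact: ae_eq_trans fg gg'.
Qed.

End Inclusions.

(** * Row vectors *)

Section Regularity.
Context (R : realType) (T : ptopologicalType) (m : probability (borel T) R).
Let bT := borel T.
Local Open Scope ereal_scope.

Lemma nonincreasing_measure_small (E : nat -> set T) (e : R) :
  (forall n, measurable (E n : set bT)) -> (forall n, E n.+1 `<=` E n) ->
  \bigcap_n E n = set0 -> (0 < e)%R -> exists n, m (E n) <= e%:E.
Proof.
move=> mE dE E0 e0.
have cv : m \o E @ \oo --> m (\bigcap_n E n).
  apply: nonincreasing_cvg_mu => //.
  - exact: le_lt_trans (probability_le1 m (mE 0%N)) (ltry 1).
  - by rewrite E0.
  - by apply/nonincreasing_seqP => n; apply/subsetPset; exact: dE.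
rewrite E0 measure0 in cv.
apply: contrapT => /forallNP h.
have : e%:E <= lim (m \o E @ \oo).
  apply: lime_ge; first by apply/cvg_ex; eexists; exact: cv.
  by apply: nearW => n; apply: ltW; rewrite ltNge; apply/negP; exact: h.
by rewrite (cvg_lim _ cv)// lee_fin leNgt e0.
Qed.

Hypothesis closed_Gdelta : forall F : set T, closed F ->
  exists O : nat -> set T, [/\ forall n, open (O n), forall n, O n.+1 `<=` O n &
    F = \bigcap_n O n].
Hypothesis sigma_compact : exists K : nat -> set T,
  [/\ forall n, compact (K n), forall n, closed (K n), forall n, K n `<=` K n.+1 &
    \bigcup_n K n = setT].

(** Approximation by closed sets from inside is stable under complements, unlike approximation by
    compact ones. These sets form a sigma-algebra containing the closed sets; compactness is
    restored at the end by cutting with the exhaustion [K]. *)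
Let approximable : set (set T) := [set A | measurable (A : set bT) /\
  forall e : R, (0 < e)%R -> exists F U : set T,
    [/\ closed F, open U, F `<=` A, A `<=` U & m (U `\` F) <= e%:E]].

Let approximable_closed F : closed F -> approximable F.
Proof.
move=> cF; split; first exact: closed_borel.
move=> e e0; have [W [uW dW FW]] := closed_Gdelta cF.
have [n hn] : exists n, m (W n `\` F) <= e%:E.
  apply: nonincreasing_measure_small => //.
  - by move=> n; apply: measurableD; [exact: open_borel|exact: closed_borel].
  - by move=> n; exact: setSD.
  - apply/seteqP; split => // x h; have [_ nF] := h 0%N I; apply: nF.
    by rewrite FW => n _; have [] := h n I.
by exists F, (W n); split => //; rewrite FW => x h; exact: h.
Qed.

Let approximableC A : approximable A -> approximable (~` A).
Proof.
move=> [mA h]; split; first exact: measurableC.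
move=> e /h[F [U [cF oU FA AU hm]]]; exists (~` U), (~` F); split.
- exact: open_closedC.
- exact: closed_openC.
- exact: subsetC.
- exact: subsetC.
- by rewrite setDE setCK setIC -setDE.
Qed.

Let approximable_bigcup (A : nat -> set T) : (forall n, approximable (A n)) ->
  approximable (\bigcup_n A n).
Proof.
move=> h; have mA n : measurable (A n : set bT) by have [] := h n.
split; first exact: bigcupT_measurable.
move=> e e0; have e2 : (0 < e / 2)%R by rewrite divr_gt0.
have /choice[FU hFU] : forall n, exists FU : set T * set T,
    [/\ closed FU.1, open FU.2, FU.1 `<=` A n, A n `<=` FU.2 &
     m (FU.2 `\` FU.1) <= (e / 2 / (2 ^ n.+1)%:R)%:E].
  move=> n; have [_ /(_ (e / 2 / (2 ^ n.+1)%:R)%R)[]] := h n.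
    by rewrite divr_gt0// ltr0n expn_gt0.
  by move=> F [U hU]; exists (F, U).
pose F n := (FU n).1; pose U n := (FU n).2.
have cF n : closed (F n) by have [] := hFU n.
have oU n : open (U n) by have [] := hFU n.
have FA n : F n `<=` A n by have [] := hFU n.
have AU n : A n `<=` U n by have [] := hFU n.
have mF n : measurable (F n : set bT) by exact: closed_borel.
have mU n : measurable (U n : set bT) by exact: open_borel.
(* An infinite union of closed sets need not be closed, so it is cut after finitely many terms, at
   the cost of the other [e / 2]. *)
pose G N := \bigcup_(n in `I_N) F n.
have cG N : closed (G N) by apply: closed_bigcup => // n _; exact: cF.
have mG N : measurable (G N : set bT) by exact: closed_borel.
have mbF : measurable (\bigcup_n F n : set bT) by exact: bigcupT_measurable.
have [N hN] : exists N, m (\bigcup_n F n `\` G N) <= (e / 2)%:E.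
  apply: nonincreasing_measure_small => //.
  - by move=> N; exact: measurableD.
  - move=> N; apply: setDS; apply: bigcup_subset => n /= nN; exact: ltnW.
  - apply/seteqP; split => // x hx; have [[n _ Fx] _] := hx 0%N I.
    by have [_] := hx n.+1 I; apply; exists n => /=.
exists (G N), (\bigcup_n U n); split => //.
- by apply: bigcup_open => n _; exact: oU.
- by move=> x [n _ /FA Ax]; exists n.
- by move=> x [n _ /AU Ux]; exists n.
have sub : \bigcup_n U n `\` G N `<=`
    \bigcup_n (U n `\` F n) `|` (\bigcup_n F n `\` G N).
  move=> x [[n _ Ux] nG]; case: (pselect ((\bigcup_n F n) x)) => Fx; first by right.
  by left; exists n => //; split => // Fnx; apply: Fx; exists n.
have mUF n : measurable (U n `\` F n : set bT) by exact: measurableD.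
have mbUF : measurable (\bigcup_n (U n `\` F n) : set bT) by exact: bigcupT_measurable.
apply: le_trans (le_measure m _ _ sub) _; rewrite ?inE.
- by apply: measurableD => //; exact: bigcupT_measurable.
- by apply: measurableU => //; exact: measurableD.
apply: le_trans (measureU2 m mbUF (measurableD mbF (mG N))) _.
rewrite [X in _ <= X%:E]splitr EFinD; apply: leeD => //.
apply: le_trans (epsilon_trick0 xpredT (ltW e2)).
apply: le_trans (measure_sigma_subadditive _ _ _ (@subset_refl _ _)) _ => //.
by apply: lee_nneseries => // n _; have [] := hFU n.
Qed.

Lemma regular_borel_probability : regular m.
Proof.
have all_approx A : measurable (A : set bT) -> approximable A.
  apply: smallest_sub => [|W oW]; last first.
    by rewrite -[W]setCK; apply/approximableC/approximable_closed/open_closedC.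
  split.
  - by apply: approximable_closed; exact: closed0.
  - by move=> B aB; rewrite setTD; exact: approximableC.
  - by move=> B aB; exact: approximable_bigcup.
move=> A mA e e0; have e2 : (0 < e / 2)%R by rewrite divr_gt0.
have [_ /(_ _ e2)[F [U [cF oU FA AU hm]]]] := all_approx A mA.
have [K [coK cK iK KT]] := sigma_compact.
have mF : measurable (F : set bT) by exact: closed_borel.
have mU : measurable (U : set bT) by exact: open_borel.
have mK n : measurable (K n : set bT) by exact: closed_borel.
have [n hn] : exists n, m (F `\` K n) <= (e / 2)%:E.
  apply: nonincreasing_measure_small => //.
  - by move=> n; exact: measurableD.
  - by move=> n; exact: setDS.
  - apply/seteqP; split => // x h; have [n _ Kx] : (\bigcup_n K n) x by rewrite KT.
    by have [_] := h n I; apply.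
exists (K n `&` F), U; split; first split => //.
- exact: compact_closedI.
- exact: measurableI.
- by apply: subset_trans FA; exact: subIsetr.
have sub : U `\` (K n `&` F) `<=` (U `\` F) `|` (F `\` K n).
  move=> x [Ux nKF]; case: (pselect (F x)) => Fx; last by left.
  by right; split => // Kx; apply: nKF.
apply: le_trans (le_measure m _ _ sub) _; rewrite ?inE.
- by apply: measurableD => //; exact: measurableI.
- by apply: measurableU; exact: measurableD.
apply: le_trans (measureU2 m _ _) _; try exact: measurableD.
by rewrite [X in _ <= X%:E]splitr EFinD; exact: leeD.
Qed.

End Regularity.

(** * Countable base, closed sets as countable intersections of open sets, and compact exhaustion
    for row vectors *)

Section RowVectors.
Context (R : realType) (d : nat).
Let V : ptopologicalType := 'rV[R]_d.

Definition row_box (x : 'rV[R]_d) (e : R) : set 'rV[R]_d :=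
  [set v | forall j, `|v ord0 j - x ord0 j| < e].

Lemma open_row_box x e : open (row_box x e).
Proof.
rewrite openE => v hv.
exists (fun _ j => [set r | `|r - x ord0 j| < e]).
  move=> i j; rewrite ord1; apply: open_nbhs_nbhs; split; last exact: hv.
  apply: (open_comp (f := fun r => `|r - x ord0 j|) (D := [set t | t < e])); last exact: open_lt.
  by move=> r _; apply: cvg_norm; apply: cvgB; [exact: cvg_id|exact: cvg_cst].
by move=> w hw j; exact: hw.
Qed.

Lemma row_box_nbhs (v : 'rV[R]_d) (O : set 'rV[R]_d) : nbhs v O ->
  exists2 e : R, 0 < e & row_box v e `<=` O.
Proof.
move=> /nbhs_ballP[e /= e0 vO]; exists e => // w hw; apply: vO; split => // i j.
by rewrite ord1 -ball_normE /= distrC.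
Qed.

Lemma row_box_center x e : 0 < e -> row_box x e x.
Proof. by move=> e0 j; rewrite subrr normr0. Qed.

Lemma exists_row_base : exists B : nat -> set V, open_base B.
Proof.
pose q_ k := (odflt (0, 0%N) (unpickle k) : 'rV[rat]_d * nat).
pose B k := row_box (map_mx ratr (q_ k).1) (q_ k).2.+1%:R^-1.
exists B; split; first by move=> k; exact: open_row_box.
move=> O x oO Ox; have [e e0 xO] := row_box_nbhs (open_nbhs_nbhs (conj oO Ox)).
(* Half of [e], because [x] and [v] are each within one radius of the rational centre. *)
have [n hn] : exists n, n.+1%:R^-1 < e / 2.
  have e2 : 0 < e / 2 by rewrite divr_gt0.
  by have [n _ /(_ n (leqnn n))] := near_infty_natSinv_lt (PosNum e2); exists n.
have n0 : 0 < n.+1%:R^-1 :> R by rewrite invr_gt0.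
have /choice[q hq] : forall j, exists q : rat, `|x ord0 j - ratr q| < n.+1%:R^-1.
  move=> j; have : x ord0 j - n.+1%:R^-1 < x ord0 j by rewrite ltrBlDr ltrDl.
  move=> /rat_in_itvoo[q]; rewrite in_itv /= => /andP[q1 q2]; exists q.
  move: q1 n0; rewrite ltr_norml; set r := n.+1%:R^-1 => q1 n0.
  by apply/andP; split; lra.
exists (pickle (\row_j q j, n)); rewrite /B /q_ pickleK /=; split.
  by move=> j; rewrite !mxE.
move=> v hv; apply: xO => j; have := hv j; have := hq j; rewrite !mxE.
rewrite !ltr_norml; move: hn; set r := n.+1%:R^-1 => hn.
by move=> /andP[h1 h2] /andP[h3 h4]; apply/andP; split; lra.
Qed.

Lemma row_closed_Gdelta (F : set V) : closed F ->
  exists O : nat -> set V, [/\ forall n, open (O n), forall n, O n.+1 `<=` O n &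
    F = \bigcap_n O n].
Proof.
move=> cF; exists (fun n => \bigcup_(x in F) row_box x n.+1%:R^-1); split.
- by move=> n; apply: bigcup_open => x _; exact: open_row_box.
- move=> n v [x Fx xv]; exists x => // j; apply: lt_le_trans (xv j) _.
  by rewrite lef_pV2 ?posrE// ler_nat.
- apply/seteqP; split=> [v Fv n _|v hv].
    by exists v => //; apply: row_box_center; rewrite invr_gt0.
  apply: cF => O /row_box_nbhs[e e0 vO].
  have [n _ /(_ n (leqnn n)) hn] := near_infty_natSinv_lt (PosNum e0).
  have [x Fx xv] := hv n I; exists x; split => //; apply: vO => j.
  by rewrite distrC; apply: lt_trans (xv j) hn.
Qed.

Lemma row_sigma_compact : exists K : nat -> set V,
  [/\ forall n, compact (K n), forall n, closed (K n), forall n, K n `<=` K n.+1 &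
    \bigcup_n K n = setT].
Proof.
pose K n : set 'rV[R]_d := [set v | forall j, v ord0 j \in `[- n%:R, n%:R]].
exists K; split.
- by move=> n; apply: (@rV_compact R d (fun=> [set` `[- n%:R, n%:R]])) => j; exact: segment_compact.
- move=> n; have -> : K n = \bigcap_(j in setT)
      ((fun v : 'rV[R]_d => v ord0 j) @^-1` [set` `[- n%:R, n%:R]]).
    by apply/seteqP; split => v h j; [move=> _|]; exact: h.
  apply: closed_bigI => j _; apply: closed_comp => [v _|]; last exact: interval_closed.
  exact: coord_continuous.
- move=> n v h j; have := h j; rewrite /= !in_itv /= => /andP[h1 h2].
  have : n%:R <= n.+1%:R :> R by rewrite ler_nat.
  by move=> h3; apply/andP; split; lra.
- apply/seteqP; split => // v _.
  pose M := \sum_j `|v ord0 j|.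
  have [n hn] : exists n, M < n%:R by exists (Num.truncn M).+1; exact: truncnS_gt.
  exists n => // j /=; rewrite in_itv /= -ler_norml; apply: le_trans (ltW hn).
  by rewrite /M (bigD1 j)//= lerDl sumr_ge0.
Qed.

Lemma regular_row (m : probability (borel V) R) : regular m.
Proof. exact: regular_borel_probability row_closed_Gdelta row_sigma_compact. Qed.

End RowVectors.

Theorem proposition4p1 (R : realType) (d : nat)
    (rho mu : probability (borel 'rV[R]_d) R)
    (c : 'rV[R]_d * 'rV[R]_d -> R) (a b : 'rV[R]_d -> R) :
  continuous c ->
  upper_semicontinuous a -> upper_semicontinuous b ->
  rho.-integrable setT (EFin \o a) -> mu.-integrable setT (EFin \o b) ->
  (forall x y, `|c (x, y)| <= a x + b y) ->
  modulo_null rho (Phi rho mu c) =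
  modulo_null rho
    [set phi | [/\ L1 rho phi,
       forall x, proj_opt rho mu c x -> phi x \is a fin_num &
       forall x x', proj_opt rho mu c x -> proj_opt rho mu c x' ->
         (phi x - phi x' <= lambda rho mu c x x')%E]].
Proof.
move=> cc _ _ ia ib cab.
have [B bB] := exists_row_base R d.
apply: (Phi_lambda_potentials bB bB _ _ cc ia ib cab); exact: regular_row.
Qed.
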